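(* The functor $S_\bullet\colon \mathcal{DC}at_{aug}^{st}\to \mathcal{U}2\mathcal{S}eg$ (the generalized Waldhausen $S_\bullet$-construction) and the functor $\mathcal{P}\colon \mathcal{U}2\mathcal{S}eg\to\mathcal{DC}at_{aug}^{st}$ (the path construction) define an equivalence of categories $$S_\bullet\colon \mathcal{DC}at_{aug}^{st}\;\overset{\simeq}{\longleftrightarrow}\;\mathcal{U}2\mathcal{S}eg\colon \mathcal{P}$$ between the category of augmented stable double categories and the category of unital 2-Segal sets (that is, the composites $S_\bullet\mathcal{P}$ and $\mathcal{P}S_\bullet$ are naturally isomorphic to the identity functors). This equivalence restricts to an equivalence of categories $$S_\bullet\colon \mathcal{DC}at_{*}^{st}\;\overset{\simeq}{\longleftrightarrow}\;\mathcal{U}2\mathcal{S}eg_*\colon \mathcal{P}$$ between the category of stable pointed double categories and the category of reduced unital 2-Segal sets.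
   Context: **2-Segal sets.** Let $X$ be a simplicial set. For $n\ge 3$ let $\mathcal{T}$ be a triangulation of a regular $(n+1)$-gon whose vertices are cyclically labelled $0,1,\dots,n$. It consists of $n-1$ triangles (three-element subsets of $\{0,\dots,n\}$). The $\mathcal{T}$-Segal map $X_n\to X_2\times_{X_1}\cdots\times_{X_1}X_2$ ($n-1$ factors) sends $x$ to the family of its 2-dimensional faces spanned by the triangles of $\mathcal{T}$, where the target is the set of families $(x_\tau)_{\tau}$ of elements of $X_2$ indexed by the triangles of $\mathcal T$ such that for any two triangles sharing an edge $\{i,j\}$ the corresponding faces in $X_1$ agree. $X$ is a 2-Segal set if for all $n\ge3$ and all $\mathcal{T}$ the $\mathcal{T}$-Segal map is a bijection. A 2-Segal set is reduced if $X_0$ is a single point. It is unital if for all $n\ge2$ and $0\le i\le n-1$ the square with top map $\alpha_i\colon X_{n-1}\to X_0$, left map $s_i\colon X_{n-1}\to X_n$, right map $s_0\colon X_0\to X_1$ and bottom map $\beta_i\colon X_n\to X_1$ is a pullback, where $\alpha_i$ is induced by $[0]\to[n-1]$, $0\mapsto i$, and $\beta_i$ by $[1]\to[n]$, $0\mapsto i$, $1\mapsto i+1$. $\mathcal{U}2\mathcal{S}eg$ and $\mathcal{U}2\mathcal{S}eg_*$ are the full subcategories of simplicial sets on the unital 2-Segal sets and the reduced unital 2-Segal sets. **Double categories.** A (small) double category $\mathcal{D}$ is an internal category in small categories. Explicitly: sets $Ob\,\mathcal D$ (objects), $Hor\,\mathcal D$ (horizontal morphisms, written $\rightarrowtail$),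 $Ver\,\mathcal D$ (vertical morphisms, written $\twoheadrightarrow$), $Sq\,\mathcal D$ (squares); categories $\mathcal{H}or_0\mathcal D=(Ob\,\mathcal D,Hor\,\mathcal D)$ and $\mathcal{V}er_0\mathcal D=(Ob\,\mathcal D,Ver\,\mathcal D)$; maps $s_h,t_h\colon Sq\,\mathcal D\to Ver\,\mathcal D$ and $s_v,t_v\colon Sq\,\mathcal D\to Hor\,\mathcal D$ compatible with sources and targets (a square $\alpha$ has left side $s_h\alpha$, right side $t_h\alpha$, top side $s_v\alpha$, bottom side $t_v\alpha$, with horizontal morphisms pointing right and vertical ones pointing down); associative horizontal composition $\circ_h$ of squares (when $t_h\alpha=s_h\beta$) and vertical composition $\circ_v$ (when $t_v\alpha=s_v\beta$), with identity squares $\mathrm{id}^h_j$ for vertical $j$ and $\mathrm{id}^v_f$ for horizontal $f$, all compatible with sources, targets, compositions and identities in $\mathcal{H}or_0\mathcal D$ and $\mathcal{V}er_0\mathcal D$, and satisfying the interchange law. A double functor is an internal functor, i.e. maps on objects, horizontal morphisms, vertical morphisms and squares preserving all structure. An augmentation of $\mathcal D$ is a set of objects $A\subseteq Ob\,\mathcal D$ such that for every object $d$ there are unique morphisms $a\rightarrowtail d$ in $Hor\,\mathcal D$ and $d\twoheadrightarrow a'$ in $Ver\,\mathcal D$ with $a,a'\in A$. An augmented double category is a double category with a chosen augmentation; a double functor between such is augmented if it sends the augmentation of the source into that of the target. A double category is pointed if it is equipped with a distinguished object $*$ that is initial in $\mathcal{H}or_0\mathcal D$ and terminal in $\mathcal{V}er_0\mathcal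 D$; pointed double functors preserve $*$. Pointed double categories are exactly the augmented ones whose augmentation is a singleton $A=\{*\}$. $\mathcal D$ is stable if both maps $(s_h,s_v)\colon Sq\,\mathcal D\to Ver\,\mathcal D\times_{Ob\,\mathcal D}Hor\,\mathcal D$ (pairs with common source) and $(t_h,t_v)\colon Sq\,\mathcal D\to Ver\,\mathcal D\times_{Ob\,\mathcal D}Hor\,\mathcal D$ (pairs with common target) are bijections. $\mathcal{DC}at_{aug}$ is the category of augmented double categories and augmented double functors, $\mathcal{DC}at_{aug}^{st}$ its full subcategory of stable objects, and $\mathcal{DC}at_*^{st}$ the category of stable pointed double categories and pointed double functors. **$S_\bullet$-construction.** For $n\ge0$ let $\mathcal W_n$ be the augmented double category with objects the pairs $ij$, $0\le i\le j\le n$; a unique horizontal morphism $ij\rightarrowtail ik$ for each $i\le j\le k$ and no others; a unique vertical morphism $ij\twoheadrightarrow kj$ for each $i\le k\le j$ and no others; exactly one square with top $ij\rightarrowtail il$, left $ij\twoheadrightarrow kj$, right $il\twoheadrightarrow kl$, bottom $kj\rightarrowtail kl$ for each $i\le k\le j\le l$ and no others; augmentation $\{ii\mid 0\le i\le n\}$. A monotone map $\varphi\colon[m]\to[n]$ acts by $ij\mapsto\varphi(i)\varphi(j)$, making $\mathcal W_\bullet$ cosimplicial. Then $S_n(\mathcal D):=\mathrm{Hom}_{\mathcal{DC}at_{aug}}(\mathcal W_n,\mathcal D)$, functorial in $\mathcal D$ by postcomposition. **Path construction.** For a unital 2-Segal set $X$, $\mathcal P X$ is the double category with object set $X_1$;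 horizontal and vertical morphism sets both equal to $X_2$; square set $X_3$. In the horizontal category the source, target and identity maps are $d_2,d_1,s_1$ and composition is $X_2\times_{X_1}X_2\xrightarrow{(d_3,d_1)^{-1}}X_3\xrightarrow{d_2}X_2$; in the vertical category they are $d_1,d_0,s_0$ and composition is $X_2\times_{X_1}X_2\xrightarrow{(d_2,d_0)^{-1}}X_3\xrightarrow{d_1}X_2$ (the maps inverted are bijections). For squares, $s_h=d_3$, $t_h=d_2$, $s_v=d_1$, $t_v=d_0$; $\circ_h$ is $X_3\times_{X_2}X_3\xrightarrow{(d_4,d_2)^{-1}}X_4\xrightarrow{d_3}X_3$ and $\circ_v$ is $X_3\times_{X_2}X_3\xrightarrow{(d_2,d_0)^{-1}}X_4\xrightarrow{d_1}X_3$; identity squares are those determined by stability ($s_2$ for horizontal, $s_0$ for vertical). The augmentation of $\mathcal PX$ is $s_0X_0\subseteq X_1$. A simplicial map $f\colon X\to X'$ induces $\mathcal Pf$ given by $f_1$ on objects, $f_2$ on horizontal and on vertical morphisms, and $f_3$ on squares. *)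

(* Defs.v *)
Set Warnings "-notation-overridden,-notation-incompatible-prefix".
From mathcomp Require Import all_boot.
From mathcomp Require Import boolp classical_sets functions.

Set Implicit Arguments.
Unset Strict Implicit.
Unset Printing Implicit Defensive.

Local Open Scope classical_set_scope.

Record category := Category {
  cobj :> Type;
  chom : cobj -> cobj -> Type;
  cid_ : forall a, chom a a;
  ccomp : forall a b c, chom b c -> chom a b -> chom a c;
  cidl : forall a b (f : chom a b), ccomp (cid_ b) f = f;
  cidr : forall a b (f : chom a b), ccomp f (cid_ a) = f;
  cassoc : forall a b c d (h : chom c d) (g : chom b c) (f : chom a b),
    ccomp h (ccomp g f) = ccomp (ccomp h g) f }.

Record functor (C D : category) := Functor {
  fobj :> C -> D;
  fmap : forall a b, chom a b -> chom (fobj a) (fobj b);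
  fmap_id : forall a, fmap (cid_ a) = cid_ (fobj a);
  fmap_comp : forall a b c (g : chom b c) (f : chom a b),
    fmap (ccomp g f) = ccomp (fmap g) (fmap f) }.

Definition id_functor (C : category) : functor C C :=
  @Functor C C id (fun _ _ f => f) (fun _ => erefl) (fun _ _ _ _ _ => erefl).

Section CompFunctor.
Variables (C D E : category) (G : functor D E) (F : functor C D).

Lemma comp_functor_id a : fmap G (fmap F (cid_ a)) = cid_ (G (F a)).
Proof. by rewrite !fmap_id. Qed.

Lemma comp_functor_comp a b c (g : chom b c) (f : chom a b) :
  fmap G (fmap F (ccomp g f)) =
  ccomp (fmap G (fmap F g)) (fmap G (fmap F f)).
Proof. by rewrite !fmap_comp. Qed.

Definition comp_functor : functor C E :=
  @Functor C E (fun a => G (F a)) (fun a b f => fmap G (fmap F f))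
    comp_functor_id comp_functor_comp.
End CompFunctor.

Definition is_iso (C : category) (a b : C) (f : chom a b) : Prop :=
  exists g : chom b a, ccomp g f = cid_ a /\ ccomp f g = cid_ b.

Definition naturally_isomorphic (C D : category) (F G : functor C D) : Prop :=
  exists eta : forall a : C, chom (F a) (G a),
    (forall a b (f : chom a b),
       ccomp (eta b) (fmap F f) = ccomp (fmap G f) (eta a)) /\
    (forall a, is_iso (eta a)).

Definition mutually_inverse_equivalences (C D : category)
    (F : functor C D) (G : functor D C) : Prop :=
  naturally_isomorphic (comp_functor F G) (id_functor D) /\
  naturally_isomorphic (comp_functor G F) (id_functor C).

Definition full_sub (C : category) (P : C -> Prop) : category :=
  @Category {a : C | P a} (fun a b => chom (sval a) (sval b))
    (fun a => cid_ (sval a)) (fun a b c g f => ccomp g f)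
    (fun a b f => cidl f) (fun a b f => cidr f)
    (fun a b c d h g f => cassoc h g f).

Definition incl (C : category) (P : C -> Prop) : functor (full_sub P) C :=
  @Functor (full_sub P) C sval (fun _ _ f => f)
    (fun _ => erefl) (fun _ _ _ _ _ => erefl).

Definition corestrict (C D : category) (Q : D -> Prop) (F : functor C D)
    (FQ : forall a, Q (F a)) : functor C (full_sub Q) :=
  @Functor C (full_sub Q) (fun a => exist Q (F a) (FQ a))
    (fun a b f => fmap F f) (fun a => fmap_id F a)
    (fun a b c g f => fmap_comp F g f).

(* The ordered set [n] = {0, ..., n} is the ordinal type 'I_n.+1. *)
Record mono (m n : nat) := Mono {
  mono_fun :> 'I_m.+1 -> 'I_n.+1;
  mono_homo : {homo mono_fun : i j / (i <= j)%N} }.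

Lemma mono_ext m n (f g : mono m n) : (forall i, f i = g i :> nat) -> f = g.
Proof.
case: f g => [f hf] [g hg] /= E.
have {}E : f = g by apply/funext => i; apply/val_inj/E.
by subst g; congr Mono; apply: Prop_irrelevance.
Qed.

Definition mono_id n : mono n n := @Mono n n id (fun _ _ h => h).

Definition mono_comp l m n (g : mono m n) (f : mono l m) : mono l n :=
  @Mono l n (g \o f) (fun _ _ h => mono_homo g (mono_homo f h)).

Record sset := SSet {
  simp :> nat -> Type;
  act : forall m n, mono m n -> simp n -> simp m;
  act_id : forall n (x : simp n), act (mono_id n) x = x;
  act_comp : forall l m n (g : mono m n) (f : mono l m) (x : simp n),
    act (mono_comp g f) x = act f (act g x) }.

Record smap (X Y : sset) := SMap {
  smap_fun :> forall n, X n -> Y n;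
  smap_nat : forall m n (f : mono m n) (x : X n),
    smap_fun (act f x) = act f (smap_fun x) }.

Lemma smap_ext (X Y : sset) (f g : smap X Y) :
  (forall n (x : X n), f n x = g n x) -> f = g.
Proof.
case: f g => [f hf] [g hg] /= E.
have {}E : f = g.
  by apply: functional_extensionality_dep => n; apply/funext => x; apply: E.
by subst g; congr SMap; apply: Prop_irrelevance.
Qed.

Definition smap_id X : smap X X := @SMap X X (fun _ x => x) (fun _ _ _ _ => erefl).

Lemma smap_comp_nat X Y Z (g : smap Y Z) (f : smap X Y) m n (p : mono m n) x :
  g _ (f _ (act p x)) = act p (g _ (f _ x)).
Proof. by rewrite !smap_nat. Qed.

Definition smap_comp X Y Z (g : smap Y Z) (f : smap X Y) : smap X Z :=
  @SMap X Z (fun n x => g n (f n x)) (smap_comp_nat g f).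

Lemma smap_idl X Y (f : smap X Y) : smap_comp (smap_id Y) f = f.
Proof. exact: smap_ext. Qed.
Lemma smap_idr X Y (f : smap X Y) : smap_comp f (smap_id X) = f.
Proof. exact: smap_ext. Qed.
Lemma smap_assoc X Y Z T (h : smap Z T) (g : smap Y Z) (f : smap X Y) :
  smap_comp h (smap_comp g f) = smap_comp (smap_comp h g) f.
Proof. exact: smap_ext. Qed.

Definition sSet : category :=
  @Category sset smap smap_id smap_comp smap_idl smap_idr smap_assoc.

(* Cofaces and codegeneracies.  The index is a natural number; it is only
   meaningful for i <= n.+1, resp. i <= n (larger indices are truncated). *)
Lemma coface_subproof n i (k : 'I_n.+1) : (bump i k < n.+2)%N.
Proof.
by rewrite ltnS /bump; apply: (leq_add (leq_b1 _) (ltn_ord k : (k <= n)%N)).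
Qed.

Lemma coface_homo n i :
  {homo (fun k : 'I_n.+1 => Ordinal (coface_subproof i k)) : j k / (j <= k)%N}.
Proof. by move=> j k /=; rewrite leq_bump2. Qed.

Definition coface n i : mono n n.+1 := Mono (@coface_homo n i).

Lemma codegen_subproof n i (k : 'I_n.+2) : (minn n (unbump i k) < n.+1)%N.
Proof. by rewrite ltnS geq_minl. Qed.

Lemma codegen_homo n i :
  {homo (fun k : 'I_n.+2 => Ordinal (codegen_subproof i k)) : j k / (j <= k)%N}.
Proof.
move=> j k /= jk; rewrite leq_min geq_minl /= geq_min; apply/orP; right.
rewrite /unbump; case: (ltnP i j) => ij; first by rewrite (leq_trans ij jk) leq_sub2r.
rewrite subn0; case: (ltnP i k) => ik; last by rewrite subn0.
by rewrite subn1 (leq_trans ij) // -ltnS prednK // (leq_ltn_trans _ ik).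
Qed.

Definition codegen n i : mono n.+1 n := Mono (@codegen_homo n i).

Definition face (X : sset) n (i : nat) (x : X n.+1) : X n := act (coface n i) x.
Definition degen (X : sset) n (i : nat) (x : X n) : X n.+1 :=
  act (codegen n i) x.

Lemma vertex_homo n (i : 'I_n.+1) : {homo (fun _ : 'I_1 => i) : j k / (j <= k)%N}.
Proof. by []. Qed.

Definition vertex n (i : 'I_n.+1) : mono 0 n := Mono (vertex_homo i).

Lemma edge_subproof n (i : 'I_n.+1) (k : 'I_2) : (i + k < n.+2)%N.
Proof.
rewrite ltnS; apply: leq_trans (leq_add (ltn_ord i : (i <= n)%N) (ltn_ord k : (k <= 1)%N)) _.
by rewrite addn1.
Qed.

Lemma edge_homo n (i : 'I_n.+1) :
  {homo (fun k : 'I_2 => Ordinal (edge_subproof i k)) : j k / (j <= k)%N}.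
Proof. by move=> j k; rewrite /= leq_add2l. Qed.

Definition edge n (i : 'I_n.+1) : mono 1 n.+1 := Mono (edge_homo i).

(* A chord (i, j), i < j, of the polygon with vertices 0, ..., n is one of its
   sides or diagonals. *)
Definition crossing n (c c' : 'I_n.+1 * 'I_n.+1) : bool :=
  [&& c.1 < c'.1, c'.1 < c.2 & c.2 < c'.2]%N ||
  [&& c'.1 < c.1, c.1 < c'.2 & c'.2 < c.2]%N.

Definition noncrossing n (E : {set 'I_n.+1 * 'I_n.+1}) : bool :=
  [forall c in E, (c.1 < c.2)%N] &&
  [forall c in E, forall c' in E, ~~ crossing c c'].

(* A triangulation is given by the set of all its edges, that is, by a maximal
   set of pairwise non-crossing chords. *)
Definition triangulation n (E : {set 'I_n.+1 * 'I_n.+1}) : Prop :=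
  maxset (@noncrossing n) E.

(* The triangles of E are those with all three edges in E; a triangle with
   vertices i < j < k is encoded by the monotone map (0,1,2) |-> (i,j,k). *)
Definition triangle n (E : {set 'I_n.+1 * 'I_n.+1}) :=
  {t : mono 2 n | forall a b : 'I_3, (a < b)%N -> (t a, t b) \in E}.

(* coface 1 a enumerates the edges of a triangle. *)
Definition segal_target (X : sset) n (E : {set 'I_n.+1 * 'I_n.+1}) :
    set (triangle E -> X 2) :=
  [set x | forall (t t' : triangle E) (a b : 'I_3),
     mono_comp (sval t) (coface 1 a) = mono_comp (sval t') (coface 1 b) ->
     face a (x t) = face b (x t')].

Definition segal_map (X : sset) n (E : {set 'I_n.+1 * 'I_n.+1}) (x : X n) :
    triangle E -> X 2 :=
  fun t => act (sval t) x.

Definition two_segal (X : sset) : Prop :=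
  forall n (E : {set 'I_n.+1 * 'I_n.+1}), (3 <= n)%N -> triangulation E ->
    set_bij [set: X n] (@segal_target X n E) (@segal_map X n E).

Definition is_pullback (A B C D : Type)
    (top : A -> B) (left : A -> C) (right : B -> D) (bottom : C -> D) : Prop :=
  set_bij [set: A] [set cb : C * B | bottom cb.1 = right cb.2]
    (fun a => (left a, top a)).

(* Here n = m.+1. *)
Definition unital (X : sset) : Prop :=
  forall m (i : 'I_m.+1), (2 <= m.+1)%N ->
    is_pullback (fun x : X m => act (vertex i) x) (fun x : X m => degen i x)
      (fun p : X 0 => degen 0 p) (fun y : X m.+1 => act (edge i) y).

Definition unital_two_segal (X : sSet) : Prop := two_segal X /\ unital X.

Definition reduced (X : sset) : Prop := exists p : X 0, forall q : X 0, q = p.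

Definition U2Seg : category := full_sub unital_two_segal.
Definition U2Seg_red : category := full_sub (fun X : U2Seg => reduced (sval X)).

(* Small categories with sets O of objects and M of morphisms; mcomp f g is the
   composite of f followed by g. *)
Record cat_on (O M : Type) := CatOn {
  src : M -> O;
  tgt : M -> O;
  idm : O -> M;
  mcomp : forall f g : M, tgt f = src g -> M;
  src_idm : forall a, src (idm a) = a;
  tgt_idm : forall a, tgt (idm a) = a;
  src_mcomp : forall f g (e : tgt f = src g), src (mcomp e) = src f;
  tgt_mcomp : forall f g (e : tgt f = src g), tgt (mcomp e) = tgt g;
  mcomp_idl : forall a f (e : tgt (idm a) = src f), mcomp e = f;
  mcomp_idr : forall a f (e : tgt f = src (idm a)), mcomp e = f;
  mcompA : forall f g h (e1 : tgt f = src g) (e2 : tgt g = src h)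
    (e3 : tgt (mcomp e1) = src h) (e4 : tgt f = src (mcomp e2)),
    mcomp e3 = mcomp e4 }.

Record is_functor (O M O' M' : Type) (C : cat_on O M) (C' : cat_on O' M')
    (fo : O -> O') (fm : M -> M') : Prop := IsFunctor {
  fun_src : forall f, src C' (fm f) = fo (src C f);
  fun_tgt : forall f, tgt C' (fm f) = fo (tgt C f);
  fun_idm : forall a, fm (idm C a) = idm C' (fo a);
  fun_mcomp : forall f g (e : tgt C f = src C g)
    (e' : tgt C' (fm f) = src C' (fm g)), fm (mcomp e) = mcomp e' }.

(* hor1 is the category of vertical morphisms and squares under horizontal
   composition (source and target s_h, t_h), ver1 the category of horizontal
   morphisms and squares under vertical composition (s_v, t_v). *)
Record dcat := DCat {
  Ob : Type;
  Hor : Type;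
  Ver : Type;
  Sq : Type;
  hor0 : cat_on Ob Hor;
  ver0 : cat_on Ob Ver;
  hor1 : cat_on Ver Sq;
  ver1 : cat_on Hor Sq;
  src_ver_functor : is_functor hor1 hor0 (src ver0) (src ver1);
  tgt_ver_functor : is_functor hor1 hor0 (tgt ver0) (tgt ver1);
  idm_ver_functor : is_functor hor0 hor1 (idm ver0) (idm ver1);
  src_hor_functor : is_functor ver1 ver0 (src hor0) (src hor1);
  tgt_hor_functor : is_functor ver1 ver0 (tgt hor0) (tgt hor1);
  idm_hor_functor : is_functor ver0 ver1 (idm hor0) (idm hor1);
  interchange : forall (a b c d : Sq)
    (ab : tgt hor1 a = src hor1 b) (cd : tgt hor1 c = src hor1 d)
    (ac : tgt ver1 a = src ver1 c) (bd : tgt ver1 b = src ver1 d)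
    (abcd : tgt ver1 (mcomp ab) = src ver1 (mcomp cd))
    (acbd : tgt hor1 (mcomp ac) = src hor1 (mcomp bd)),
    mcomp abcd = mcomp acbd }.

Record dfunctor (D D' : dcat) := DFunctor {
  df_ob : Ob D -> Ob D';
  df_hor : Hor D -> Hor D';
  df_ver : Ver D -> Ver D';
  df_sq : Sq D -> Sq D';
  df_hor0 : is_functor (hor0 D) (hor0 D') df_ob df_hor;
  df_ver0 : is_functor (ver0 D) (ver0 D') df_ob df_ver;
  df_hor1 : is_functor (hor1 D) (hor1 D') df_ver df_sq;
  df_ver1 : is_functor (ver1 D) (ver1 D') df_hor df_sq }.

Lemma dfunctor_ext D D' (F G : dfunctor D D') :
  df_ob F =1 df_ob G -> df_hor F =1 df_hor G ->
  df_ver F =1 df_ver G -> df_sq F =1 df_sq G -> F = G.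
Proof.
case: F G => [fo fh fv fs p1 p2 p3 p4] [go gh gv gs q1 q2 q3 q4] /=.
move=> /funext eo /funext eh /funext ev /funext es; subst go gh gv gs.
by congr DFunctor; apply: Prop_irrelevance.
Qed.

Lemma is_functor_id O M (C : cat_on O M) : is_functor C C id id.
Proof. by split=> // f g e e'; congr mcomp; apply: Prop_irrelevance. Qed.

Lemma is_functor_comp O1 M1 O2 M2 O3 M3 (C1 : cat_on O1 M1) (C2 : cat_on O2 M2)
    (C3 : cat_on O3 M3) go gm fo fm :
  is_functor C2 C3 go gm -> is_functor C1 C2 fo fm ->
  is_functor C1 C3 (fun a => go (fo a)) (fun f => gm (fm f)).
Proof.
move=> [g1 g2 g3 g4] [f1 f2 f3 f4]; split.
- by move=> f; rewrite g1 f1.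
- by move=> f; rewrite g2 f2.
- by move=> a; rewrite f3 g3.
move=> f g e e'.
have e2 : tgt C2 (fm f) = src C2 (fm g) by rewrite f1 f2 e.
by rewrite (f4 _ _ e e2) (g4 _ _ e2 e').
Qed.

Definition dfunctor_id D : dfunctor D D :=
  DFunctor (is_functor_id (hor0 D)) (is_functor_id (ver0 D))
    (is_functor_id (hor1 D)) (is_functor_id (ver1 D)).

Definition dfunctor_comp D1 D2 D3 (G : dfunctor D2 D3) (F : dfunctor D1 D2) :
    dfunctor D1 D3 :=
  DFunctor (is_functor_comp (df_hor0 G) (df_hor0 F))
    (is_functor_comp (df_ver0 G) (df_ver0 F))
    (is_functor_comp (df_hor1 G) (df_hor1 F))
    (is_functor_comp (df_ver1 G) (df_ver1 F)).

Record aug_dcat := AugDCat {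
  adc :> dcat;
  aug : set (Ob adc);
  aug_hor : forall d, exists! f : Hor adc,
    aug (src (hor0 adc) f) /\ tgt (hor0 adc) f = d;
  aug_ver : forall d, exists! v : Ver adc,
    src (ver0 adc) v = d /\ aug (tgt (ver0 adc) v) }.

Record aug_dfunctor (D D' : aug_dcat) := AugDFunctor {
  adf :> dfunctor D D';
  adf_aug : forall a, aug a -> aug (df_ob adf a) }.

Lemma aug_dfunctor_ext (D D' : aug_dcat) (F G : aug_dfunctor D D') :
  adf F = adf G -> F = G.
Proof.
case: F G => [F p] [G q] /= E; subst G.
by congr AugDFunctor; apply: Prop_irrelevance.
Qed.

Definition aug_dfunctor_id D : aug_dfunctor D D :=
  @AugDFunctor D D (dfunctor_id D) (fun _ h => h).

Definition aug_dfunctor_comp D1 D2 D3 (G : aug_dfunctor D2 D3)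
    (F : aug_dfunctor D1 D2) : aug_dfunctor D1 D3 :=
  @AugDFunctor D1 D3 (dfunctor_comp G F) (fun _ h => adf_aug G (adf_aug F h)).

Lemma aug_dfunctor_idl D D' (F : aug_dfunctor D D') :
  aug_dfunctor_comp (aug_dfunctor_id D') F = F.
Proof. by apply/aug_dfunctor_ext/dfunctor_ext. Qed.
Lemma aug_dfunctor_idr D D' (F : aug_dfunctor D D') :
  aug_dfunctor_comp F (aug_dfunctor_id D) = F.
Proof. by apply/aug_dfunctor_ext/dfunctor_ext. Qed.
Lemma aug_dfunctor_assoc D1 D2 D3 D4 (H : aug_dfunctor D3 D4)
    (G : aug_dfunctor D2 D3) (F : aug_dfunctor D1 D2) :
  aug_dfunctor_comp H (aug_dfunctor_comp G F) =
  aug_dfunctor_comp (aug_dfunctor_comp H G) F.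
Proof. by apply/aug_dfunctor_ext/dfunctor_ext. Qed.

Definition DCat_aug : category :=
  @Category aug_dcat aug_dfunctor aug_dfunctor_id aug_dfunctor_comp
    aug_dfunctor_idl aug_dfunctor_idr aug_dfunctor_assoc.

Definition stable (D : dcat) : Prop :=
  set_bij [set: Sq D]
    [set vh : Ver D * Hor D | src (ver0 D) vh.1 = src (hor0 D) vh.2]
    (fun s => (src (hor1 D) s, src (ver1 D) s)) /\
  set_bij [set: Sq D]
    [set vh : Ver D * Hor D | tgt (ver0 D) vh.1 = tgt (hor0 D) vh.2]
    (fun s => (tgt (hor1 D) s, tgt (ver1 D) s)).

Definition DCat_aug_st : category := full_sub (fun D : DCat_aug => stable (adc D)).

Record pt_dcat := PtDCat {
  pdc :> dcat;
  pt : Ob pdc;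
  pt_initial : forall d, exists! f : Hor pdc,
    src (hor0 pdc) f = pt /\ tgt (hor0 pdc) f = d;
  pt_terminal : forall d, exists! v : Ver pdc,
    src (ver0 pdc) v = d /\ tgt (ver0 pdc) v = pt }.

Record pt_dfunctor (D D' : pt_dcat) := PtDFunctor {
  pdf :> dfunctor D D';
  pdf_pt : df_ob pdf (pt D) = pt D' }.

Lemma pt_dfunctor_ext (D D' : pt_dcat) (F G : pt_dfunctor D D') :
  pdf F = pdf G -> F = G.
Proof.
case: F G => [F p] [G q] /= E; subst G.
by congr PtDFunctor; apply: Prop_irrelevance.
Qed.

Definition pt_dfunctor_id D : pt_dfunctor D D :=
  @PtDFunctor D D (dfunctor_id D) erefl.

Lemma pt_dfunctor_comp_subproof D1 D2 D3 (G : pt_dfunctor D2 D3)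
    (F : pt_dfunctor D1 D2) : df_ob (dfunctor_comp G F) (pt D1) = pt D3.
Proof. by rewrite /= !pdf_pt. Qed.

Definition pt_dfunctor_comp D1 D2 D3 (G : pt_dfunctor D2 D3)
    (F : pt_dfunctor D1 D2) : pt_dfunctor D1 D3 :=
  PtDFunctor (pt_dfunctor_comp_subproof G F).

Lemma pt_dfunctor_idl D D' (F : pt_dfunctor D D') :
  pt_dfunctor_comp (pt_dfunctor_id D') F = F.
Proof. by apply/pt_dfunctor_ext/dfunctor_ext. Qed.
Lemma pt_dfunctor_idr D D' (F : pt_dfunctor D D') :
  pt_dfunctor_comp F (pt_dfunctor_id D) = F.
Proof. by apply/pt_dfunctor_ext/dfunctor_ext. Qed.
Lemma pt_dfunctor_assoc D1 D2 D3 D4 (H : pt_dfunctor D3 D4)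
    (G : pt_dfunctor D2 D3) (F : pt_dfunctor D1 D2) :
  pt_dfunctor_comp H (pt_dfunctor_comp G F) =
  pt_dfunctor_comp (pt_dfunctor_comp H G) F.
Proof. by apply/pt_dfunctor_ext/dfunctor_ext. Qed.

Definition DCat_pt : category :=
  @Category pt_dcat pt_dfunctor pt_dfunctor_id pt_dfunctor_comp
    pt_dfunctor_idl pt_dfunctor_idr pt_dfunctor_assoc.

Definition DCat_pt_st : category := full_sub (fun D : DCat_pt => stable (pdc D)).

(* Pointed double categories are the augmented ones with singleton
   augmentation. *)
Definition aug_of_pt (D : pt_dcat) : aug_dcat :=
  @AugDCat D [set pt D] (@pt_initial D) (@pt_terminal D).

Lemma aug_of_pt_fun_subproof D D' (F : pt_dfunctor D D') (a : Ob D) :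
  [set pt D] a -> [set pt D'] (df_ob F a).
Proof. by move=> ->; rewrite /= pdf_pt. Qed.

Definition aug_of_pt_fun D D' (F : pt_dfunctor D D') :
    aug_dfunctor (aug_of_pt D) (aug_of_pt D') :=
  @AugDFunctor (aug_of_pt D) (aug_of_pt D') F (aug_of_pt_fun_subproof F).

Definition DCat_pt_to_aug : functor DCat_pt DCat_aug.
Proof.
refine (@Functor DCat_pt DCat_aug aug_of_pt aug_of_pt_fun _ _).
- by move=> D; apply/aug_dfunctor_ext/dfunctor_ext.
- by move=> D1 D2 D3 G F; apply/aug_dfunctor_ext/dfunctor_ext.
Defined.

Definition singleton_aug (D : aug_dcat) : Prop := exists a, aug (a := D) = [set a].

Section W.
Variable n : nat.

(* WOb i j is the object ij, WHor i j k : ij >-> ik, WVer i k j : ij ->> kj, and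
   WSq i k j l is the square with top ij >-> il and left side ij ->> kj. *)
Record w_ob := WOb { wo_i : 'I_n.+1; wo_j : 'I_n.+1; wo_le : (wo_i <= wo_j)%N }.
Record w_hor := WHor { wh_i : 'I_n.+1; wh_j : 'I_n.+1; wh_k : 'I_n.+1;
  wh_le : (wh_i <= wh_j <= wh_k)%N }.
Record w_ver := WVer { wv_i : 'I_n.+1; wv_k : 'I_n.+1; wv_j : 'I_n.+1;
  wv_le : (wv_i <= wv_k <= wv_j)%N }.
Record w_sq := WSq { ws_i : 'I_n.+1; ws_k : 'I_n.+1; ws_j : 'I_n.+1;
  ws_l : 'I_n.+1; ws_le : [&& ws_i <= ws_k, ws_k <= ws_j & ws_j <= ws_l]%N }.

Lemma w_ob_ext (x y : w_ob) : wo_i x = wo_i y -> wo_j x = wo_j y -> x = y.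
Proof.
by case: x y => [? ? ?] [? ? ?] /= *; subst; congr WOb; apply: Prop_irrelevance.
Qed.
Lemma w_hor_ext (x y : w_hor) :
  wh_i x = wh_i y -> wh_j x = wh_j y -> wh_k x = wh_k y -> x = y.
Proof.
by case: x y => [? ? ? ?] [? ? ? ?] /= *; subst; congr WHor; apply: Prop_irrelevance.
Qed.
Lemma w_ver_ext (x y : w_ver) :
  wv_i x = wv_i y -> wv_k x = wv_k y -> wv_j x = wv_j y -> x = y.
Proof.
by case: x y => [? ? ? ?] [? ? ? ?] /= *; subst; congr WVer; apply: Prop_irrelevance.
Qed.
Lemma w_sq_ext (x y : w_sq) :
  ws_i x = ws_i y -> ws_k x = ws_k y -> ws_j x = ws_j y -> ws_l x = ws_l y ->
  x = y.
Proof.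
by case: x y => [? ? ? ? ?] [? ? ? ? ?] /= *; subst; congr WSq; apply: Prop_irrelevance.
Qed.

Lemma wh_src_le (f : w_hor) : (wh_i f <= wh_j f)%N.
Proof. by case/andP: (wh_le f). Qed.
Lemma wh_tgt_le (f : w_hor) : (wh_i f <= wh_k f)%N.
Proof. by case/andP: (wh_le f); apply: leq_trans. Qed.
Lemma wh_id_le (a : w_ob) : (wo_i a <= wo_j a <= wo_j a)%N.
Proof. by rewrite wo_le leqnn. Qed.
Lemma wv_src_le (v : w_ver) : (wv_i v <= wv_j v)%N.
Proof. by case/andP: (wv_le v); apply: leq_trans. Qed.
Lemma wv_tgt_le (v : w_ver) : (wv_k v <= wv_j v)%N.
Proof. by case/andP: (wv_le v). Qed.
Lemma wv_id_le (a : w_ob) : (wo_i a <= wo_i a <= wo_j a)%N.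
Proof. by rewrite wo_le leqnn. Qed.

Definition wh_src (f : w_hor) : w_ob := WOb (wh_src_le f).
Definition wh_tgt (f : w_hor) : w_ob := WOb (wh_tgt_le f).
Definition wh_id (a : w_ob) : w_hor := WHor (wh_id_le a).
Definition wv_src (v : w_ver) : w_ob := WOb (wv_src_le v).
Definition wv_tgt (v : w_ver) : w_ob := WOb (wv_tgt_le v).
Definition wv_id (a : w_ob) : w_ver := WVer (wv_id_le a).

Lemma wh_comp_le (f g : w_hor) (e : wh_tgt f = wh_src g) :
  (wh_i f <= wh_j f <= wh_k g)%N.
Proof.
case: f g e => [i j k h] [i' j' k' h'] /= [? ?]; subst i' j'.
case/andP: h h' => -> /= jk /andP[_]; exact: leq_trans.
Qed.
Definition wh_comp f g (e : wh_tgt f = wh_src g) : w_hor := WHor (wh_comp_le e).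

Lemma wv_comp_le (v w : w_ver) (e : wv_tgt v = wv_src w) :
  (wv_i v <= wv_k w <= wv_j v)%N.
Proof.
case: v w e => [i k j h] [i' k' j' h'] /= [? ?]; subst i' j'.
case/andP: h h' => ik _ /andP[kk ->]; rewrite andbT; exact: leq_trans kk.
Qed.
Definition wv_comp v w (e : wv_tgt v = wv_src w) : w_ver := WVer (wv_comp_le e).

Ltac w_ext := solve [ by []
  | by apply: w_ob_ext | by apply: w_hor_ext | by apply: w_ver_ext
  | by apply: w_sq_ext ].

Definition w_hor0 : cat_on w_ob w_hor.
Proof.
refine (@CatOn _ _ wh_src wh_tgt wh_id wh_comp _ _ _ _ _ _ _).
- by move=> a; w_ext.
- by move=> a; w_ext.
- by move=> f g e; w_ext.
- by move=> f g e; have [ei ej] := e; w_ext.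
- by move=> a f e; have [ei ej] := e; w_ext.
- by move=> a f e; have [ei ej] := e; apply: w_hor_ext.
- by move=> f g h e1 e2 e3 e4; w_ext.
Defined.

Definition w_ver0 : cat_on w_ob w_ver.
Proof.
refine (@CatOn _ _ wv_src wv_tgt wv_id wv_comp _ _ _ _ _ _ _).
- by move=> a; w_ext.
- by move=> a; w_ext.
- by move=> f g e; w_ext.
- by move=> f g e; have [ei ej] := e; w_ext.
- by move=> a f e; have [ei ej] := e; apply: w_ver_ext.
- by move=> a f e; have [ei ej] := e; w_ext.
- by move=> f g h e1 e2 e3 e4; w_ext.
Defined.

Lemma ws_sh_le (s : w_sq) : (ws_i s <= ws_k s <= ws_j s)%N.
Proof. by case/and3P: (ws_le s) => -> ->. Qed.
Lemma ws_th_le (s : w_sq) : (ws_i s <= ws_k s <= ws_l s)%N.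
Proof. by case/and3P: (ws_le s) => -> /=; apply: leq_trans. Qed.
Lemma ws_sv_le (s : w_sq) : (ws_i s <= ws_j s <= ws_l s)%N.
Proof. by case/and3P: (ws_le s) => ik kj ->; rewrite (leq_trans ik). Qed.
Lemma ws_tv_le (s : w_sq) : (ws_k s <= ws_j s <= ws_l s)%N.
Proof. by case/and3P: (ws_le s) => _ -> ->. Qed.
Lemma ws_idh_le (v : w_ver) :
  [&& wv_i v <= wv_k v, wv_k v <= wv_j v & wv_j v <= wv_j v]%N.
Proof. by case/andP: (wv_le v) => -> ->; rewrite leqnn. Qed.
Lemma ws_idv_le (f : w_hor) :
  [&& wh_i f <= wh_i f, wh_i f <= wh_j f & wh_j f <= wh_k f]%N.
Proof. by case/andP: (wh_le f) => -> ->; rewrite leqnn. Qed.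

Definition ws_sh (s : w_sq) : w_ver := WVer (ws_sh_le s).
Definition ws_th (s : w_sq) : w_ver := WVer (ws_th_le s).
Definition ws_sv (s : w_sq) : w_hor := WHor (ws_sv_le s).
Definition ws_tv (s : w_sq) : w_hor := WHor (ws_tv_le s).
Definition ws_idh (v : w_ver) : w_sq := WSq (ws_idh_le v).
Definition ws_idv (f : w_hor) : w_sq := WSq (ws_idv_le f).

Lemma ws_hcomp_le (s t : w_sq) (e : ws_th s = ws_sh t) :
  [&& ws_i s <= ws_k s, ws_k s <= ws_j s & ws_j s <= ws_l t]%N.
Proof.
case: s t e => [i k j l h] [i' k' j' l' h'] /= [? ? ?]; subst i' k' j'.
case/and3P: h h' => -> -> jl /and3P[_ _] /=; exact: leq_trans.
Qed.
Definition ws_hcomp s t (e : ws_th s = ws_sh t) : w_sq := WSq (ws_hcomp_le e).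

Lemma ws_vcomp_le (s t : w_sq) (e : ws_tv s = ws_sv t) :
  [&& ws_i s <= ws_k t, ws_k t <= ws_j s & ws_j s <= ws_l s]%N.
Proof.
case: s t e => [i k j l h] [i' k' j' l' h'] /= [? ? ?]; subst i' j' l'.
by case/and3P: h h' => ik _ -> /and3P[kk -> _]; rewrite (leq_trans ik).
Qed.
Definition ws_vcomp s t (e : ws_tv s = ws_sv t) : w_sq := WSq (ws_vcomp_le e).

Definition w_hor1 : cat_on w_ver w_sq.
Proof.
refine (@CatOn _ _ ws_sh ws_th ws_idh ws_hcomp _ _ _ _ _ _ _).
- by move=> a; w_ext.
- by move=> a; w_ext.
- by move=> f g e; w_ext.
- by move=> f g e; have [ei ek ej] := e; w_ext.
- by move=> a f e; have [ei ek ej] := e; w_ext.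
- by move=> a f e; have [ei ek ej] := e; w_ext.
- by move=> f g h e1 e2 e3 e4; w_ext.
Defined.

Definition w_ver1 : cat_on w_hor w_sq.
Proof.
refine (@CatOn _ _ ws_sv ws_tv ws_idv ws_vcomp _ _ _ _ _ _ _).
- by move=> a; w_ext.
- by move=> a; w_ext.
- by move=> f g e; w_ext.
- by move=> f g e; have [ei ek ej] := e; w_ext.
- by move=> a f e; have [ei ek ej] := e; w_ext.
- by move=> a f e; have [ei ek ej] := e; w_ext.
- by move=> f g h e1 e2 e3 e4; w_ext.
Defined.

Definition w_dcat : dcat.
Proof.
refine (@DCat w_ob w_hor w_ver w_sq w_hor0 w_ver0 w_hor1 w_ver1 _ _ _ _ _ _ _);
  try split.
all: try by move=> s; w_ext.
all: try by move=> s t e e'; have [? ? ?] := e; w_ext.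
all: try by move=> s t e e'; have [? ?] := e; w_ext.
by move=> a b c d *; w_ext.
Defined.

Definition w_aug : set (Ob w_dcat) := [set a : w_ob | wo_i a = wo_j a].

Lemma w_aug_hor d : exists! f : Hor w_dcat,
  w_aug (src (hor0 w_dcat) f) /\ tgt (hor0 w_dcat) f = d.
Proof.
case: d => [i j ij].
have h : (i <= i <= j)%N by rewrite leqnn.
exists (WHor h); split; first by split=> //; w_ext.
by case=> [i' j' k' h'] [/= + [ei ek]]; rewrite /w_aug /= => ej; subst; w_ext.
Qed.

Lemma w_aug_ver d : exists! v : Ver w_dcat,
  src (ver0 w_dcat) v = d /\ w_aug (tgt (ver0 w_dcat) v).
Proof.
case: d => [i j ij].
have h : (i <= j <= j)%N by rewrite leqnn andbT.
exists (WVer h); split; first by split=> //; w_ext.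
by case=> [i' k' j' h'] [/= [ei ej]]; rewrite /w_aug /= => ek; subst; w_ext.
Qed.

Definition W : aug_dcat := AugDCat w_aug_hor w_aug_ver.
End W.

Section WMap.
Variables (m n : nat) (p : mono m n).

Lemma wm_ob_le (a : w_ob m) : (p (wo_i a) <= p (wo_j a))%N.
Proof. exact/mono_homo/wo_le. Qed.
Lemma wm_hor_le (f : w_hor m) : (p (wh_i f) <= p (wh_j f) <= p (wh_k f))%N.
Proof. by case/andP: (wh_le f) => *; rewrite !mono_homo. Qed.
Lemma wm_ver_le (v : w_ver m) : (p (wv_i v) <= p (wv_k v) <= p (wv_j v))%N.
Proof. by case/andP: (wv_le v) => *; rewrite !mono_homo. Qed.
Lemma wm_sq_le (s : w_sq m) : [&& p (ws_i s) <= p (ws_k s),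
  p (ws_k s) <= p (ws_j s) & p (ws_j s) <= p (ws_l s)]%N.
Proof. by case/and3P: (ws_le s) => *; rewrite !mono_homo. Qed.

Definition W_dmap : dfunctor (W m) (W n).
Proof.
refine (@DFunctor (W m) (W n) (fun a => WOb (wm_ob_le a))
  (fun f => WHor (wm_hor_le f)) (fun v => WVer (wm_ver_le v))
  (fun s => WSq (wm_sq_le s)) _ _ _ _).
all: split.
all: try by move=> x; apply: w_ob_ext.
all: try by move=> x; apply: w_hor_ext.
all: try by move=> x; apply: w_ver_ext.
all: try by move=> x; apply: w_sq_ext.
all: try by move=> x y e e'; apply: w_hor_ext.
all: try by move=> x y e e'; apply: w_ver_ext.
all: try by move=> x y e e'; apply: w_sq_ext.
Defined.

Lemma W_map_aug a : aug (a := W m) a -> aug (a := W n) (df_ob W_dmap a).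
Proof. by rewrite /aug /= /w_aug /= => ->. Qed.

Definition W_map : aug_dfunctor (W m) (W n) := AugDFunctor W_map_aug.
End WMap.

Lemma W_map_id n : W_map (mono_id n) = aug_dfunctor_id (W n).
Proof.
apply/aug_dfunctor_ext/dfunctor_ext => x /=.
- exact: w_ob_ext.
- exact: w_hor_ext.
- exact: w_ver_ext.
- exact: w_sq_ext.
Qed.

Lemma W_map_comp l m n (q : mono m n) (p : mono l m) :
  W_map (mono_comp q p) = aug_dfunctor_comp (W_map q) (W_map p).
Proof.
apply/aug_dfunctor_ext/dfunctor_ext => x /=.
- exact: w_ob_ext.
- exact: w_hor_ext.
- exact: w_ver_ext.
- exact: w_sq_ext.
Qed.

Lemma S_act_id (D : aug_dcat) n (x : aug_dfunctor (W n) D) :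
  aug_dfunctor_comp x (W_map (mono_id n)) = x.
Proof. by rewrite W_map_id aug_dfunctor_idr. Qed.

Lemma S_act_comp (D : aug_dcat) l m n (q : mono m n) (p : mono l m)
    (x : aug_dfunctor (W n) D) :
  aug_dfunctor_comp x (W_map (mono_comp q p)) =
  aug_dfunctor_comp (aug_dfunctor_comp x (W_map q)) (W_map p).
Proof. by rewrite W_map_comp aug_dfunctor_assoc. Qed.

Definition S_obj (D : aug_dcat) : sset :=
  @SSet (fun n => aug_dfunctor (W n) D)
    (fun m n p x => aug_dfunctor_comp x (W_map p))
    (@S_act_id D) (@S_act_comp D).

Definition S_hom (D D' : aug_dcat) (F : aug_dfunctor D D') :
    smap (S_obj D) (S_obj D') :=
  @SMap (S_obj D) (S_obj D') (fun n x => aug_dfunctor_comp F x)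
    (fun m n p x => aug_dfunctor_assoc F x (W_map p)).

Definition S_functor : functor DCat_aug sSet.
Proof.
refine (@Functor DCat_aug sSet S_obj S_hom _ _).
- by move=> D; apply: smap_ext => n x; apply: aug_dfunctor_idl.
- move=> D1 D2 D3 G F; apply: smap_ext => n x /=.
  by rewrite /= aug_dfunctor_assoc.
Defined.

(* tri_check n s ts: the chords in s form a triangulation with triangles ts. *)
Definition ncross (c c' : nat * nat) : bool :=
  [&& c.1 < c'.1, c'.1 < c.2 & c.2 < c'.2]%N ||
  [&& c'.1 < c.1, c.1 < c'.2 & c'.2 < c.2]%N.

Definition tri_check (n : nat) (s : seq (nat * nat)) (ts : seq (nat * nat * nat)) :=
  [&& (3 <= n)%N, all (fun c => (c.1 < c.2)%N) s,
    all (fun c => all (fun c' => ~~ ncross c c') s) s,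
    all (fun i => all (fun j => (i < j)%N ==>
      ((i, j) \in s) || has (ncross (i, j)) s) (iota 0 n.+1)) (iota 0 n.+1),
    all (fun c => (c.1 <= n)%N && (c.2 <= n)%N) s,
    all (fun c => all (fun d => (c.2 == d.1) && ((c.1, d.2) \in s) ==>
      ((c.1, c.2, d.2) \in ts)) s) s &
    all (fun t : nat * nat * nat => [&& t.1 \in s, (t.1.2, t.2) \in s
      & (t.1.1, t.2) \in s]) ts].

Definition chords n (s : seq (nat * nat)) : {set 'I_n.+1 * 'I_n.+1} :=
  finset (fun c => (val c.1, val c.2) \in s).

Lemma chords_triangulation n s ts : tri_check n s ts -> triangulation (chords n s).
Proof.
case/and5P=> _ /allP slt /allP snc /allP smax /andP[/allP srg _].
apply/maxsetP; split.
  apply/andP; split; apply/forall_inP => -[i j]; rewrite inE => ij.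
    exact: (slt _ ij).
  apply/forall_inP => -[k l]; rewrite inE => kl.
  exact: (allP (snc _ ij) _ kl).
move=> B /andP[/forall_inP Blt /forall_inP Bnc] sB.
apply/eqP; rewrite finset.eqEsubset sB andbT; apply/fintype.subsetP => -[i j] Bij; rewrite inE.
have ni (k : 'I_n.+1) : (k : nat) \in iota 0 n.+1 by rewrite mem_iota ltn_ord.
have := allP (smax _ (ni i)) _ (ni j).
rewrite (Blt _ Bij) /= => /orP[//|/hasP[[k l] kl x]].
have /andP[/= kn ln] := srg _ kl.
have Ekl : (Ordinal (kn : (k < n.+1)%N), Ordinal (ln : (l < n.+1)%N)) \in B.
  by apply: (fintype.subsetP sB); rewrite inE.
by have /forall_inP/(_ _ Ekl) := Bnc _ Bij; rewrite /crossing [X in ~~ X]x.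
Qed.

Definition vert n (t : mono 2 n) : nat * nat * nat :=
  (val (t (@Ordinal 3 0 isT)), val (t (@Ordinal 3 1 isT)), val (t (@Ordinal 3 2 isT))).

Lemma vert_inj n (t t' : mono 2 n) : vert t = vert t' -> t = t'.
Proof.
case=> e0 e1 e2; apply: mono_ext.
by case=> [[|[|[|k]]] //= h]; rewrite (bool_irrelevance h isT).
Qed.

Lemma vert_mem n s ts (t : mono 2 n) : tri_check n s ts ->
  (forall a b : 'I_3, (a < b)%N -> (t a, t b) \in chords n s) <-> vert t \in ts.
Proof.
case/and5P=> _ _ _ _ /and3P[_ /allP tin /allP tout]; split.
  move=> h; have := h (@Ordinal 3 0 isT) (@Ordinal 3 1 isT) isT.
  have := h (@Ordinal 3 1 isT) (@Ordinal 3 2 isT) isT.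
  have := h (@Ordinal 3 0 isT) (@Ordinal 3 2 isT) isT.
  rewrite !inE /= => h02 h12 h01.
  by have := allP (tin _ h01) _ h12; rewrite /= eqxx h02 /=.
move=> /tout /and3P[h01 h12 h02].
by case=> [[|[|[|a]]] //= ha]; case=> [[|[|[|b]]] //= hb] _; rewrite inE /=
   (bool_irrelevance ha isT) (bool_irrelevance hb isT).
Qed.

Definition tri_edge (a : nat) (t : nat * nat * nat) : nat * nat :=
  match a with 0 => (t.1.2, t.2) | 1 => (t.1.1, t.2) | _ => t.1 end.

Section Fill.
Variables (X : sset) (XS : two_segal X).

Lemma fill_uniq n s ts : tri_check n s ts -> forall y z : X n,
  (forall t : mono 2 n, vert t \in ts -> act t y = act t z) -> y = z.
Proof.
move=> chk y z h; have n3 : (3 <= n)%N by case/andP: chk.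
have [_ inj _] := XS n3 (chords_triangulation chk).
apply: inj; rewrite ?inE //.
by apply: functional_extensionality_dep => -[t ht]; apply/h/(vert_mem t chk).
Qed.

Lemma fill_exists n s ts (x : nat * nat * nat -> X 2) : tri_check n s ts ->
  (forall t t', t \in ts -> t' \in ts -> forall a b, (a < 3)%N -> (b < 3)%N ->
    tri_edge a t = tri_edge b t' -> face a (x t) = face b (x t')) ->
  exists y : X n, forall t : mono 2 n, vert t \in ts -> act t y = x (vert t).
Proof.
move=> chk cx; have n3 : (3 <= n)%N by case/andP: chk.
have [_ _ sur] := XS n3 (chords_triangulation chk).
have h : segal_target (fun t : triangle (chords n s) => x (vert (sval t))).
  move=> [t ht] [t' ht'] a b /= e.
  apply: cx => //; [exact/(vert_mem t chk)|exact/(vert_mem t' chk)|].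
  have e0 : val (mono_comp t (coface 1 a) (@Ordinal 2 0 isT)) =
            val (mono_comp t' (coface 1 b) (@Ordinal 2 0 isT)) by rewrite e.
  have e1 : val (mono_comp t (coface 1 a) (@Ordinal 2 1 isT)) =
            val (mono_comp t' (coface 1 b) (@Ordinal 2 1 isT)) by rewrite e.
  have E (u : mono 2 n) (c : 'I_3) : tri_edge c (vert u) =
    (val (mono_comp u (coface 1 c) (@Ordinal 2 0 isT)),
     val (mono_comp u (coface 1 c) (@Ordinal 2 1 isT))).
    by case: c => [[|[|[|c]]] hc] //=; congr (_, _); congr (val (u _)); apply/val_inj.
  by rewrite !E e0 e1.
have [y _ hy] := sur _ h.
exists y => t ht.
have := congr1 (fun F => F (exist _ t ((vert_mem t chk).2 ht))) hy.
by [].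
Qed.
End Fill.

Ltac simp_eq :=
  rewrite /face /degen -?act_comp; first
  [ congr (act _ _); apply: mono_ext; by case=> [[|[|[|[|[|k]]]]] ?]
  | rewrite -[RHS]act_id; congr (act _ _); apply: mono_ext;
    by case=> [[|[|[|[|[|k]]]]] ?]
  | rewrite -[LHS]act_id; congr (act _ _); apply: mono_ext;
    by case=> [[|[|[|[|[|k]]]]] ?] ].

Definition sq02_edges := [:: (0,1); (1,2); (2,3); (0,3); (0,2)]%N.
Definition sq02_tris := [:: (0,1,2); (0,2,3)]%N.
Definition sq13_edges := [:: (0,1); (1,2); (2,3); (0,3); (1,3)]%N.
Definition sq13_tris := [:: (0,1,3); (1,2,3)]%N.
Definition pentagon_sides := [:: (0,1); (1,2); (2,3); (3,4); (0,4)]%N.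
Definition horz_edges := [:: (1,3), (0,3) & pentagon_sides]%N.
Definition horz_tris := [:: (0,1,3); (1,2,3); (0,3,4)]%N.
Definition vert_edges := [:: (1,3), (1,4) & pentagon_sides]%N.
Definition vert_tris := [:: (1,3,4); (1,2,3); (0,1,4)]%N.
Definition fan0_edges := [:: (0,2), (0,3) & pentagon_sides]%N.
Definition fan0_tris := [:: (0,1,2); (0,2,3); (0,3,4)]%N.
Definition fan4_edges := [:: (1,4), (2,4) & pentagon_sides]%N.
Definition fan4_tris := [:: (0,1,4); (1,2,4); (2,3,4)]%N.

Lemma chk02 : tri_check 3 sq02_edges sq02_tris. Proof. by vm_compute. Qed.
Lemma chk13 : tri_check 3 sq13_edges sq13_tris. Proof. by vm_compute. Qed.
Lemma chkh : tri_check 4 horz_edges horz_tris. Proof. by vm_compute. Qed.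
Lemma chkv : tri_check 4 vert_edges vert_tris. Proof. by vm_compute. Qed.
Lemma chkf0 : tri_check 4 fan0_edges fan0_tris. Proof. by vm_compute. Qed.
Lemma chkf4 : tri_check 4 fan4_edges fan4_tris. Proof. by vm_compute. Qed.

Definition sel2 (A : Type) (t1 : nat * nat * nat) (x1 x2 : A) t :=
  if t == t1 then x1 else x2.
Definition sel3 (A : Type) (t1 t2 : nat * nat * nat) (x1 x2 x3 : A) t :=
  if t == t1 then x1 else if t == t2 then x2 else x3.

Section LowFill.
Variables (X : sset) (XS : two_segal X).

Lemma act_vert n (y : X n) (t t' : mono 2 n) :
  vert t = vert t' -> act t y = act t' y.
Proof. by move/vert_inj ->. Qed.

Lemma uniq02 (y z : X 3) :
  face 3 y = face 3 z -> face 1 y = face 1 z -> y = z.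
Proof.
move=> h3 h1; apply: (fill_uniq XS chk02) => t; rewrite !inE.
case/orP=> /eqP e.
- by rewrite !(act_vert _ (e : _ = vert (coface 2 3))).
- by rewrite !(act_vert _ (e : _ = vert (coface 2 1))).
Qed.

Lemma uniq13 (y z : X 3) :
  face 2 y = face 2 z -> face 0 y = face 0 z -> y = z.
Proof.
move=> h3 h1; apply: (fill_uniq XS chk13) => t; rewrite !inE.
case/orP=> /eqP e.
- by rewrite !(act_vert _ (e : _ = vert (coface 2 2))).
- by rewrite !(act_vert _ (e : _ = vert (coface 2 0))).
Qed.

Lemma fill02 (f g : X 2) : face 1 f = face 2 g ->
  exists! z : X 3, face 3 z = f /\ face 1 z = g.
Proof.
move=> e; have [|z hz] := fill_exists (x := sel2 (0,1,2)%N f g) XS chk02.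
  move=> t t'; rewrite !inE.
  by case/orP=> /eqP ->; case/orP=> /eqP ->;
    case=> [|[|[|a]]] //; case=> [|[|[|b]]] //.
exists z; split; first by split; [apply: (hz (coface 2 3))|apply: (hz (coface 2 1))].
by move=> z' [h3 h1]; apply: uniq02; rewrite ?h3 ?h1;
  [apply: (hz (coface 2 3))|apply: (hz (coface 2 1))].
Qed.

Lemma fill13 (j k : X 2) : face 0 j = face 1 k ->
  exists! z : X 3, face 2 z = j /\ face 0 z = k.
Proof.
move=> e; have [|z hz] := fill_exists (x := sel2 (0,1,3)%N j k) XS chk13.
  move=> t t'; rewrite !inE.
  by case/orP=> /eqP ->; case/orP=> /eqP ->;
    case=> [|[|[|a]]] //; case=> [|[|[|b]]] //.
exists z; split; first by split; [apply: (hz (coface 2 2))|apply: (hz (coface 2 0))].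
by move=> z' [h3 h1]; apply: uniq13; rewrite ?h3 ?h1;
  [apply: (hz (coface 2 2))|apply: (hz (coface 2 0))].
Qed.

Lemma fillf0 (f g h : X 2) : face 1 f = face 2 g -> face 1 g = face 2 h ->
  exists z : X 4, [/\ face 3 (face 4 z) = f, face 1 (face 4 z) = g
                    & face 1 (face 1 z) = h].
Proof.
move=> e e'; have [|z hz] := fill_exists (x := sel3 (0,1,2)%N (0,2,3)%N f g h) XS chkf0.
  move=> t t'; rewrite !inE.
  by case/or3P=> /eqP ->; case/or3P=> /eqP ->;
    case=> [|[|[|a]]] //; case=> [|[|[|b]]] //.
exists z; rewrite /face -!act_comp.
by split; [apply: (hz (mono_comp (coface 3 4) (coface 2 3)))
          |apply: (hz (mono_comp (coface 3 4) (coface 2 1)))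
          |apply: (hz (mono_comp (coface 3 1) (coface 2 1)))].
Qed.

Lemma fillf4 (j k l : X 2) : face 0 j = face 1 k -> face 0 k = face 1 l ->
  exists z : X 4, [/\ face 2 (face 2 z) = j, face 2 (face 0 z) = k
                    & face 0 (face 0 z) = l].
Proof.
move=> e e'; have [|z hz] := fill_exists (x := sel3 (0,1,4)%N (1,2,4)%N j k l) XS chkf4.
  move=> t t'; rewrite !inE.
  by case/or3P=> /eqP ->; case/or3P=> /eqP ->;
    case=> [|[|[|a]]] //; case=> [|[|[|b]]] //.
exists z; rewrite /face -!act_comp.
by split; [apply: (hz (mono_comp (coface 3 2) (coface 2 2)))
          |apply: (hz (mono_comp (coface 3 0) (coface 2 2)))
          |apply: (hz (mono_comp (coface 3 0) (coface 2 0)))].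
Qed.

Lemma fillh (a b : X 3) : face 2 a = face 3 b ->
  exists! z : X 4, face 4 z = a /\ face 2 z = b.
Proof.
move=> e.
have [|z hz] := fill_exists
    (x := sel3 (0,1,3)%N (1,2,3)%N (face 2 a) (face 0 a) (face 1 b)) XS chkh.
  move=> t t'; rewrite !inE.
  case/or3P=> /eqP ->; case/or3P=> /eqP ->;
    case=> [|[|[|i]]] //; case=> [|[|[|j]]] //= _ _ _; rewrite /sel3 /= ?e;
    try (by simp_eq); rewrite -?e; by simp_eq.
have h1 : face 2 (face 4 z) = face 2 a.
  rewrite /face -act_comp; exact: (hz (mono_comp (coface 3 4) (coface 2 2))).
have h2 : face 0 (face 4 z) = face 0 a.
  rewrite /face -act_comp; exact: (hz (mono_comp (coface 3 4) (coface 2 0))).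
have h3 : face 1 (face 2 z) = face 1 b.
  rewrite /face -act_comp; exact: (hz (mono_comp (coface 3 2) (coface 2 1))).
exists z; split.
  split; first exact: uniq13.
  by apply: uniq02 => //; rewrite -e -h1; simp_eq.
move=> z' [ha hb]; apply: (fill_uniq XS chkh) => t ht; rewrite (hz _ ht).
move: ht; rewrite !inE; case/or3P=> /eqP E; rewrite E /sel3 /= -?ha -?hb
  /face -?act_comp; exact/esym/act_vert.
Qed.

Lemma fillv (a b : X 3) : face 0 a = face 1 b ->
  exists! z : X 4, face 2 z = a /\ face 0 z = b.
Proof.
move=> e.
have [|z hz] := fill_exists
    (x := sel3 (1,3,4)%N (1,2,3)%N (face 1 b) (face 3 b) (face 2 a)) XS chkv.
  move=> t t'; rewrite !inE.
  case/or3P=> /eqP ->; case/or3P=> /eqP ->;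
    case=> [|[|[|i]]] //; case=> [|[|[|j]]] //= _ _ _; rewrite /sel3 /= -?e;
    try (by simp_eq); rewrite ?e; by simp_eq.
have h1 : face 1 (face 0 z) = face 1 b.
  rewrite /face -act_comp; exact: (hz (mono_comp (coface 3 0) (coface 2 1))).
have h2 : face 3 (face 0 z) = face 3 b.
  rewrite /face -act_comp; exact: (hz (mono_comp (coface 3 0) (coface 2 3))).
have h3 : face 2 (face 2 z) = face 2 a.
  rewrite /face -act_comp; exact: (hz (mono_comp (coface 3 2) (coface 2 2))).
exists z; split.
  split; last exact: uniq02.
  by apply: uniq13 => //; rewrite e -h1; simp_eq.
move=> z' [ha hb]; apply: (fill_uniq XS chkv) => t ht; rewrite (hz _ ht).
move: ht; rewrite !inE; case/or3P=> /eqP E; rewrite E /sel3 /= -?ha -?hb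
  /face -?act_comp; exact/esym/act_vert.
Qed.
End LowFill.

Definition inv2 (A B C : Type) (p : A -> B) (q : A -> C) b c
    (h : exists! a, p a = b /\ q a = c) : A := projT1 (cid h).

Lemma inv2P A B C (p : A -> B) (q : A -> C) b c
    (h : exists! a, p a = b /\ q a = c) : p (inv2 h) = b /\ q (inv2 h) = c.
Proof. by rewrite /inv2; case: cid => a []. Qed.

Lemma inv2E A B C (p : A -> B) (q : A -> C) b c
    (h : exists! a, p a = b /\ q a = c) a : p a = b -> q a = c -> inv2 h = a.
Proof. by rewrite /inv2; case: cid => a' [_ u] /= pa qa; apply: u. Qed.

Section Path.
Variables (X : sset) (XS : two_segal X) (XU : unital X).

Definition ph_comp (f g : X 2) (e : face 1 f = face 2 g) : X 2 :=
  face 2 (inv2 (fill02 XS e)).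
Definition pv_comp (j k : X 2) (e : face 0 j = face 1 k) : X 2 :=
  face 1 (inv2 (fill13 XS e)).
Definition psh_comp (a b : X 3) (e : face 2 a = face 3 b) : X 3 :=
  face 3 (inv2 (fillh XS e)).
Definition psv_comp (a b : X 3) (e : face 0 a = face 1 b) : X 3 :=
  face 1 (inv2 (fillv XS e)).

Lemma ph_compE f g (e : face 1 f = face 2 g) z :
  face 3 z = f -> face 1 z = g -> ph_comp e = face 2 z.
Proof. by move=> h1 h2; rewrite /ph_comp (inv2E _ h1 h2). Qed.
Lemma pv_compE f g (e : face 0 f = face 1 g) z :
  face 2 z = f -> face 0 z = g -> pv_comp e = face 1 z.
Proof. by move=> h1 h2; rewrite /pv_comp (inv2E _ h1 h2). Qed.
Lemma psh_compE f g (e : face 2 f = face 3 g) z :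
  face 4 z = f -> face 2 z = g -> psh_comp e = face 3 z.
Proof. by move=> h1 h2; rewrite /psh_comp (inv2E _ h1 h2). Qed.
Lemma psv_compE f g (e : face 0 f = face 1 g) z :
  face 2 z = f -> face 0 z = g -> psv_comp e = face 1 z.
Proof. by move=> h1 h2; rewrite /psv_comp (inv2E _ h1 h2). Qed.

Lemma ph_src f g (e : face 1 f = face 2 g) : face 2 (ph_comp e) = face 2 f.
Proof.
by rewrite /ph_comp; case: (inv2P (fill02 XS e)); set z := inv2 _ => za zb; rewrite -za; simp_eq.
Qed.
Lemma ph_tgt f g (e : face 1 f = face 2 g) : face 1 (ph_comp e) = face 1 g.
Proof.
by rewrite /ph_comp; case: (inv2P (fill02 XS e)); set z := inv2 _ => za zb; rewrite -zb; simp_eq.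
Qed.
Lemma pv_src f g (e : face 0 f = face 1 g) : face 1 (pv_comp e) = face 1 f.
Proof.
by rewrite /pv_comp; case: (inv2P (fill13 XS e)); set z := inv2 _ => za zb; rewrite -za; simp_eq.
Qed.
Lemma pv_tgt f g (e : face 0 f = face 1 g) : face 0 (pv_comp e) = face 0 g.
Proof.
by rewrite /pv_comp; case: (inv2P (fill13 XS e)); set z := inv2 _ => za zb; rewrite -zb; simp_eq.
Qed.

Definition P_hor0 : cat_on (X 1) (X 2).
Proof.
refine (@CatOn (X 1) (X 2) (face 2) (face 1) (degen 1) ph_comp _ _ ph_src ph_tgt _ _ _).
- by move=> a; simp_eq.
- by move=> a; simp_eq.
- move=> a f e.
  have ea : a = face 2 f by rewrite -e; simp_eq.
  rewrite (@ph_compE _ _ _ (degen 1 f)); [simp_eq| |simp_eq].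
  by rewrite ea; simp_eq.
- move=> a f e.
  have ea : a = face 1 f by rewrite e; simp_eq.
  rewrite (@ph_compE _ _ _ (degen 2 f)); [simp_eq|simp_eq|].
  by rewrite ea; simp_eq.
- move=> f g h e1 e2 e3 e4.
  have [z [zf zg zh]] := fillf0 XS e1 e2.
  rewrite (@ph_compE _ _ _ (face 2 z)); first 1 last.
  + by rewrite (ph_compE _ zf zg); simp_eq.
  + by rewrite -zh; simp_eq.
  rewrite (@ph_compE _ _ _ (face 3 z)); first by simp_eq.
  + by rewrite -zf; simp_eq.
  + rewrite (@ph_compE _ _ _ (face 1 z)) //; first by simp_eq.
    by rewrite -zg; simp_eq.
Defined.

Definition P_ver0 : cat_on (X 1) (X 2).
Proof.
refine (@CatOn (X 1) (X 2) (face 1) (face 0) (degen 0) pv_comp _ _ pv_src pv_tgt _ _ _).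
- by move=> a; simp_eq.
- by move=> a; simp_eq.
- move=> a f e.
  have ea : a = face 1 f by rewrite -e; simp_eq.
  rewrite (@pv_compE _ _ _ (degen 0 f)); [simp_eq| |simp_eq].
  by rewrite ea; simp_eq.
- move=> a f e.
  have ea : a = face 0 f by rewrite e; simp_eq.
  rewrite (@pv_compE _ _ _ (degen 1 f)); [simp_eq|simp_eq|].
  by rewrite ea; simp_eq.
- move=> f g h e1 e2 e3 e4.
  have [z [zf zg zh]] := fillf4 XS e1 e2.
  rewrite (@pv_compE _ _ _ (face 1 z)); first 1 last.
  + rewrite (@pv_compE _ _ _ (face 3 z)); first by simp_eq.
      by rewrite -zf; simp_eq.
    by rewrite -zg; simp_eq.
  + by rewrite -zh; simp_eq.
  rewrite (@pv_compE _ _ _ (face 2 z)); first by simp_eq.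
  + by rewrite -zf; simp_eq.
  + rewrite (@pv_compE _ _ _ (face 0 z)) //; by simp_eq.
Defined.
Lemma psh_src a b (e : face 2 a = face 3 b) : face 3 (psh_comp e) = face 3 a.
Proof.
by rewrite /psh_comp; case: (inv2P (fillh XS e)); set z := inv2 _ => za zb; rewrite -za; simp_eq.
Qed.
Lemma psh_tgt a b (e : face 2 a = face 3 b) : face 2 (psh_comp e) = face 2 b.
Proof.
by rewrite /psh_comp; case: (inv2P (fillh XS e)); set z := inv2 _ => za zb; rewrite -zb; simp_eq.
Qed.
Lemma psv_src a b (e : face 0 a = face 1 b) : face 1 (psv_comp e) = face 1 a.
Proof.
by rewrite /psv_comp; case: (inv2P (fillv XS e)); set z := inv2 _ => za zb; rewrite -za; simp_eq.
Qed.
Lemma psv_tgt a b (e : face 0 a = face 1 b) : face 0 (psv_comp e) = face 0 b.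
Proof.
by rewrite /psv_comp; case: (inv2P (fillv XS e)); set z := inv2 _ => za zb; rewrite -zb; simp_eq.
Qed.

Lemma psh_top a b (e : face 2 a = face 3 b) (e' : face 1 (face 1 a) = face 2 (face 1 b)) :
  face 1 (psh_comp e) = ph_comp e'.
Proof.
rewrite /psh_comp; case: (inv2P (fillh XS e)); set z := inv2 _ => za zb.
rewrite (@ph_compE _ _ _ (face 1 z)); first by simp_eq.
  by rewrite -za; simp_eq.
by rewrite -zb; simp_eq.
Qed.
Lemma psh_bot a b (e : face 2 a = face 3 b) (e' : face 1 (face 0 a) = face 2 (face 0 b)) :
  face 0 (psh_comp e) = ph_comp e'.
Proof.
rewrite /psh_comp; case: (inv2P (fillh XS e)); set z := inv2 _ => za zb.
rewrite (@ph_compE _ _ _ (face 0 z)); first by simp_eq.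
  by rewrite -za; simp_eq.
by rewrite -zb; simp_eq.
Qed.
Lemma psv_left a b (e : face 0 a = face 1 b) (e' : face 0 (face 3 a) = face 1 (face 3 b)) :
  face 3 (psv_comp e) = pv_comp e'.
Proof.
rewrite /psv_comp; case: (inv2P (fillv XS e)); set z := inv2 _ => za zb.
rewrite (@pv_compE _ _ _ (face 4 z)); first by simp_eq.
  by rewrite -za; simp_eq.
by rewrite -zb; simp_eq.
Qed.
Lemma psv_right a b (e : face 0 a = face 1 b) (e' : face 0 (face 2 a) = face 1 (face 2 b)) :
  face 2 (psv_comp e) = pv_comp e'.
Proof.
rewrite /psv_comp; case: (inv2P (fillv XS e)); set z := inv2 _ => za zb.
rewrite (@pv_compE _ _ _ (face 3 z)); first by simp_eq.
  by rewrite -za; simp_eq.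
by rewrite -zb; simp_eq.
Qed.

Lemma corner_tl (s : X 3) : face 1 (face 3 s) = face 2 (face 1 s). Proof. simp_eq. Qed.
Lemma corner_tr (s : X 3) : face 1 (face 1 s) = face 1 (face 2 s). Proof. simp_eq. Qed.
Lemma corner_bl (s : X 3) : face 0 (face 3 s) = face 2 (face 0 s). Proof. simp_eq. Qed.
Lemma corner_br (s : X 3) : face 0 (face 2 s) = face 1 (face 0 s). Proof. simp_eq. Qed.

Definition P_hor1 : cat_on (X 2) (X 3).
Proof.
refine (@CatOn (X 2) (X 3) (face 3) (face 2) (degen 2) psh_comp _ _ psh_src psh_tgt _ _ _).
- by move=> a; simp_eq.
- by move=> a; simp_eq.
- move=> a f e.
  have ea : a = face 3 f by rewrite -e; simp_eq.
  have e' : face 1 (face 1 (degen 2 a)) = face 2 (face 1 f).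
    by rewrite ea; simp_eq.
  apply: (uniq02 XS); first by rewrite psh_src ea; simp_eq.
  rewrite (psh_top e e') (@ph_compE _ _ _ (degen 1 (face 1 f))) //; try by simp_eq.
  by rewrite ea; simp_eq.
- move=> a f e.
  have ea : a = face 2 f by rewrite e; simp_eq.
  have e' : face 1 (face 1 f) = face 2 (face 1 (degen 2 a)).
    by rewrite ea; simp_eq.
  apply: (uniq02 XS); first by rewrite psh_src.
  rewrite (psh_top e e') (@ph_compE _ _ _ (degen 2 (face 1 f))) //; try by simp_eq.
  by rewrite ea; simp_eq.
- move=> f g h e1 e2 e3 e4.
  apply: (uniq02 XS); first by rewrite !psh_src.
  have e1' : face 1 (face 1 f) = face 2 (face 1 g).
    by rewrite corner_tr -corner_tl e1.
  have e2' : face 1 (face 1 g) = face 2 (face 1 h).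
    by rewrite corner_tr -corner_tl e2.
  have e3' : face 1 (face 1 (psh_comp e1)) = face 2 (face 1 h).
    by rewrite corner_tr -corner_tl e3.
  have e4' : face 1 (face 1 f) = face 2 (face 1 (psh_comp e2)).
    by rewrite corner_tr -corner_tl e4.
  rewrite (psh_top e3 e3') (psh_top e4 e4').
  move: e3' e4'; rewrite (psh_top e1 e1') (psh_top e2 e2') => e3' e4'.
  exact: (mcompA (c := P_hor0) e3' e4').
Defined.

Definition P_ver1 : cat_on (X 2) (X 3).
Proof.
refine (@CatOn (X 2) (X 3) (face 1) (face 0) (degen 0) psv_comp _ _ psv_src psv_tgt _ _ _).
- by move=> a; simp_eq.
- by move=> a; simp_eq.
- move=> a f e.
  have ea : a = face 1 f by rewrite -e; simp_eq.
  have e' : face 0 (face 3 (degen 0 a)) = face 1 (face 3 f).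
    by rewrite ea; simp_eq.
  apply: (uniq02 XS); last by rewrite psv_src ea; simp_eq.
  rewrite (psv_left e e') (@pv_compE _ _ _ (degen 0 (face 3 f))) //; try by simp_eq.
  by rewrite ea; simp_eq.
- move=> a f e.
  have ea : a = face 0 f by rewrite e; simp_eq.
  have e' : face 0 (face 3 f) = face 1 (face 3 (degen 0 a)).
    by rewrite ea; simp_eq.
  apply: (uniq02 XS); last by rewrite psv_src.
  rewrite (psv_left e e') (@pv_compE _ _ _ (degen 1 (face 3 f))) //; try by simp_eq.
  by rewrite ea; simp_eq.
- move=> f g h e1 e2 e3 e4.
  apply: (uniq02 XS); last by rewrite !psv_src.
  have e1' : face 0 (face 3 f) = face 1 (face 3 g).
    by rewrite corner_bl corner_tl e1.
  have e2' : face 0 (face 3 g) = face 1 (face 3 h).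
    by rewrite corner_bl corner_tl e2.
  have e3' : face 0 (face 3 (psv_comp e1)) = face 1 (face 3 h).
    by rewrite corner_bl corner_tl e3.
  have e4' : face 0 (face 3 f) = face 1 (face 3 (psv_comp e2)).
    by rewrite corner_bl corner_tl e4.
  rewrite (psv_left e3 e3') (psv_left e4 e4').
  move: e3' e4'; rewrite (psv_left e1 e1') (psv_left e2 e2') => e3' e4'.
  exact: (mcompA (c := P_ver0) e3' e4').
Defined.

Lemma P_interchange (a b c d : X 3)
  (ab : face 2 a = face 3 b) (cd : face 2 c = face 3 d)
  (ac : face 0 a = face 1 c) (bd : face 0 b = face 1 d)
  (abcd : face 0 (psh_comp ab) = face 1 (psh_comp cd))
  (acbd : face 2 (psv_comp ac) = face 3 (psv_comp bd)) :
  psv_comp abcd = psh_comp acbd.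
Proof.
apply: (uniq02 XS).
  have e1 : face 0 (face 3 a) = face 1 (face 3 c).
    by rewrite corner_bl corner_tl ac.
  have e2 : face 0 (face 3 (psh_comp ab)) = face 1 (face 3 (psh_comp cd)).
    by rewrite corner_bl corner_tl abcd.
  rewrite psh_src (psv_left abcd e2) (psv_left ac e1).
  move: e2; rewrite !psh_src => e2; congr pv_comp; exact: Prop_irrelevance.
have e1 : face 1 (face 1 a) = face 2 (face 1 b).
  by rewrite corner_tr -corner_tl ab.
have e2 : face 1 (face 1 (psv_comp ac)) = face 2 (face 1 (psv_comp bd)).
  by rewrite corner_tr -corner_tl acbd.
rewrite psv_src (psh_top acbd e2) (psh_top ab e1).
move: e2; rewrite !psv_src => e2; congr ph_comp; exact: Prop_irrelevance.
Qed.

Lemma face_degen01 (x : X 2) : face 1 (degen 0 x) = x. Proof. simp_eq. Qed.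
Lemma face_degen32 (x : X 2) : face 3 (degen 2 x) = x. Proof. simp_eq. Qed.

Lemma P_idm_h_functor : is_functor P_hor0 P_hor1 (idm P_ver0) (idm P_ver1).
Proof.
split=> /=.
- by move=> f; simp_eq.
- by move=> f; simp_eq.
- by move=> a; simp_eq.
move=> f g e e'.
apply: (uniq02 XS).
  rewrite psh_src [LHS](_ : _ = degen 0 (face 2 (ph_comp e))); last by simp_eq.
  by rewrite ph_src; simp_eq.
have e2 : face 1 (face 1 (degen 0 f)) = face 2 (face 1 (degen 0 g)).
  by rewrite corner_tr -corner_tl e'.
rewrite (psh_top e' e2) face_degen01.
move: e2; rewrite !face_degen01 => e2; congr ph_comp; exact: Prop_irrelevance.
Qed.

Lemma P_idm_v_functor : is_functor P_ver0 P_ver1 (idm P_hor0) (idm P_hor1).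
Proof.
split=> /=.
- by move=> f; simp_eq.
- by move=> f; simp_eq.
- by move=> a; simp_eq.
move=> f g e e'.
apply: (uniq02 XS); last first.
  rewrite psv_src [LHS](_ : _ = degen 1 (face 1 (pv_comp e))); last by simp_eq.
  by rewrite pv_src; simp_eq.
have e2 : face 0 (face 3 (degen 2 f)) = face 1 (face 3 (degen 2 g)).
  by rewrite corner_bl corner_tl e'.
rewrite (psv_left e' e2) face_degen32.
move: e2; rewrite !face_degen32 => e2; congr pv_comp; exact: Prop_irrelevance.
Qed.

Definition P_dcat : dcat.
Proof.
refine (@DCat (X 1) (X 2) (X 2) (X 3) P_hor0 P_ver0 P_hor1 P_ver1
  _ _ P_idm_h_functor _ _ P_idm_v_functor P_interchange).
- split=> [s|s|j|a b e e'] /=; by [simp_eq | apply: psh_top].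
- split=> [s|s|j|a b e e'] /=; by [simp_eq | apply: psh_bot].
- split=> [s|s|j|a b e e'] /=; by [simp_eq | apply: psv_left].
- split=> [s|s|j|a b e e'] /=; by [simp_eq | apply: psv_right].
Defined.

Definition P_aug : set (Ob P_dcat) := range (@degen X 0 0).

Lemma P_aug_hor d : exists! f : Hor P_dcat,
  P_aug (src (hor0 P_dcat) f) /\ tgt (hor0 P_dcat) f = d.
Proof.
exists (degen 0 d); split.
  split=> /=; last by simp_eq.
  by exists (face 1 d) => //; simp_eq.
move=> f /= [[p _ pf] fd].
have [_ _ sur] := @XU 1 ord0 isT.
have [/=|x _ [xf xp]] := sur (f, p).
  by rewrite [RHS]pf /face; congr (act _ _); apply: mono_ext; case=> [[|[|k]] ?].
by rewrite -fd -xf; congr (degen 0 _); simp_eq.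
Qed.

Lemma P_aug_ver d : exists! v : Ver P_dcat,
  src (ver0 P_dcat) v = d /\ P_aug (tgt (ver0 P_dcat) v).
Proof.
exists (degen 1 d); split.
  split=> /=; first by simp_eq.
  by exists (face 0 d) => //; simp_eq.
move=> f /= [fd [p _ pf]].
have [_ _ sur] := @XU 1 ord_max isT.
have [/=|x _ [xf xp]] := sur (f, p).
  by rewrite [RHS]pf /face; congr (act _ _); apply: mono_ext; case=> [[|[|k]] ?].
by rewrite -fd -xf; congr (degen 1 _); simp_eq.
Qed.

Definition P_obj : aug_dcat := AugDCat P_aug_hor P_aug_ver.

Lemma P_stable : stable P_dcat.
Proof.
split; split => [s _|s t _ _ [h1 h2]|[v h] /= e].
- exact: corner_tl.
- exact: uniq02.
- by have [z [[z1 z2] _]] := fill02 XS e; exists z; rewrite ?z1 ?z2.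
- exact: corner_br.
- exact: uniq13.
- by have [z [[z1 z2] _]] := fill13 XS e; exists z; rewrite ?z1 ?z2.
Qed.

End Path.

Lemma smap_face X Y (F : smap X Y) n i (x : X n.+1) : F _ (face i x) = face i (F _ x).
Proof. exact: smap_nat. Qed.
Lemma smap_degen X Y (F : smap X Y) n i (x : X n) : F _ (degen i x) = degen i (F _ x).
Proof. exact: smap_nat. Qed.

Section PathMap.
Variables (X Y : U2Seg) (F : chom X Y).
Let XS : two_segal (sval X) := (svalP X).1.
Let XU : unital (sval X) := (svalP X).2.
Let YS : two_segal (sval Y) := (svalP Y).1.
Let YU : unital (sval Y) := (svalP Y).2.
Let f : smap (sval X) (sval Y) := F.

Definition P_dmap : dfunctor (P_obj XS XU) (P_obj YS YU).
Proof.
refine (@DFunctor (P_obj XS XU) (P_obj YS YU) (f 1) (f 2) (f 2) (f 3) _ _ _ _);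
  split=> /=; try (by move=> x; rewrite ?smap_face ?smap_degen).
- move=> a b e e'; rewrite /ph_comp smap_face; symmetry; apply: ph_compE.
    by rewrite -smap_face (inv2P (fill02 XS e)).1.
  by rewrite -smap_face (inv2P (fill02 XS e)).2.
- move=> a b e e'; rewrite /pv_comp smap_face; symmetry; apply: pv_compE.
    by rewrite -smap_face (inv2P (fill13 XS e)).1.
  by rewrite -smap_face (inv2P (fill13 XS e)).2.
- move=> a b e e'; rewrite /psh_comp smap_face; symmetry; apply: psh_compE.
    by rewrite -smap_face (inv2P (fillh XS e)).1.
  by rewrite -smap_face (inv2P (fillh XS e)).2.
- move=> a b e e'; rewrite /psv_comp smap_face; symmetry; apply: psv_compE.
    by rewrite -smap_face (inv2P (fillv XS e)).1.
  by rewrite -smap_face (inv2P (fillv XS e)).2.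
Defined.

Lemma P_map_aug a : aug (a := P_obj XS XU) a -> aug (a := P_obj YS YU) (df_ob P_dmap a).
Proof. by case=> p _ <- /=; exists (f 0 p) => //; rewrite smap_degen. Qed.

Definition P_hom : aug_dfunctor (P_obj XS XU) (P_obj YS YU) := AugDFunctor P_map_aug.
End PathMap.

Definition P_functor : functor U2Seg DCat_aug_st.
Proof.
refine (@Functor U2Seg DCat_aug_st
  (fun X => exist (fun D : DCat_aug => stable (adc D))
              (P_obj (svalP X).1 (svalP X).2)
              (P_stable (svalP X).1))
  P_hom _ _).
- by move=> X; apply/aug_dfunctor_ext/dfunctor_ext.
- by move=> X Y Z G F; apply/aug_dfunctor_ext/dfunctor_ext.
Defined.

Section PtOfAug.
Variables (D : aug_dcat) (h : singleton_aug D).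

Definition aug_point : Ob D := projT1 (cid h).

Lemma aug_pointE : aug (a := D) = [set aug_point].
Proof. exact: projT2 (cid h). Qed.

Lemma aug_point_initial d : exists! f : Hor D,
  src (hor0 D) f = aug_point /\ tgt (hor0 D) f = d.
Proof. by have := aug_hor d; rewrite aug_pointE. Qed.

Lemma aug_point_terminal d : exists! v : Ver D,
  src (ver0 D) v = d /\ tgt (ver0 D) v = aug_point.
Proof. by have := aug_ver d; rewrite aug_pointE. Qed.

Definition pt_of_aug : pt_dcat := PtDCat aug_point_initial aug_point_terminal.

End PtOfAug.

Lemma pt_of_augK D (h : singleton_aug D) : aug_of_pt (pt_of_aug h) = D.
Proof.
suff ext (C : dcat) (A A' : set (Ob C)) Ah Av Ah' Av' :
    A = A' -> @AugDCat C A Ah Av = @AugDCat C A' Ah' Av'.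
  by case: D h => C A Ah Av h; apply: ext; rewrite -aug_pointE.
by move=> E; subst A'; congr AugDCat; apply: Prop_irrelevance.
Qed.

Lemma pt_of_aug_fun_subproof D D' (h : singleton_aug D) (h' : singleton_aug D')
  (F : aug_dfunctor D D') : df_ob F (aug_point h) = aug_point h'.
Proof.
have : aug (df_ob F (aug_point h)) by apply: adf_aug; rewrite aug_pointE.
by rewrite (aug_pointE h').
Qed.

Definition DCat_aug_to_pt : functor (full_sub (C := DCat_aug) singleton_aug) DCat_pt.
Proof.
refine (@Functor (full_sub (C := DCat_aug) singleton_aug) DCat_pt
  (fun D => pt_of_aug (svalP D))
  (fun D D' F => @PtDFunctor (pt_of_aug (svalP D)) (pt_of_aug (svalP D')) F
     (pt_of_aug_fun_subproof _ _ F)) _ _).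
- by move=> D; apply/pt_dfunctor_ext/dfunctor_ext.
- by move=> D1 D2 D3 G F; apply/pt_dfunctor_ext/dfunctor_ext.
Defined.

Definition S_st (HS : forall D : DCat_aug_st, unital_two_segal (S_obj (sval D))) :
    functor DCat_aug_st U2Seg :=
  corestrict (F := comp_functor S_functor (incl _)) HS.

Definition DCat_pt_st_to_aug : functor DCat_pt_st DCat_aug_st :=
  corestrict (Q := fun D : DCat_aug => stable (adc D))
    (F := comp_functor DCat_pt_to_aug (incl _)) (fun D : DCat_pt_st => svalP D).

Definition S_pt (HS : forall D : DCat_aug_st, unital_two_segal (S_obj (sval D)))
    (HS_red : forall D : DCat_pt_st, reduced (S_obj (aug_of_pt (sval D)))) :
    functor DCat_pt_st U2Seg_red :=
  corestrict (Q := fun X : U2Seg => reduced (sval X))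
    (F := comp_functor (S_st HS) DCat_pt_st_to_aug) HS_red.

Lemma P_singleton_aug (X : U2Seg_red) : singleton_aug (sval (P_functor (sval X))).
Proof.
have [p hp] := svalP X; exists (degen 0 p); apply/seteqP.
by split=> [_ [q _ <-]|_ ->]; [rewrite (hp q) | exists p].
Qed.

Definition P_pt : functor U2Seg_red DCat_pt_st :=
  corestrict (Q := fun D : DCat_pt => stable (pdc D))
    (F := comp_functor DCat_aug_to_pt
       (corestrict (F := comp_functor (incl _) (comp_functor P_functor (incl _)))
          P_singleton_aug))
    (fun X => svalP (P_functor (sval X))).

(* Main.v *)
Require Import Defs.
From mathcomp Require Import all_boot.
From mathcomp Require Import boolp classical_sets.
From mathcomp Require Import zify.

Set Implicit Arguments.
Unset Strict Implicit.
Unset Printing Implicit Defensive.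

(* Removing ears one at a time reduces the 2-Segal condition for all
   triangulations to the squares X_{n+2} -> X_{n+1} x_{X_1} X_2 given by the
   faces [i+1] and (i, i+1, i+2).

   For D stable, an n-simplex of S(D) is the same as its top row, a string
   00 >-> 01 >-> ... >-> 0n of horizontal morphisms starting in the augmentation:
   the vertical morphisms 0i ->> ii are unique, and every other part of the
   diagram is obtained by filling spans with squares.  An ear at i + 1 is glued on
   by filling two cospans below the top row, so S(D) is 2-Segal.  A square whose
   bottom is an identity and whose right side ends in the augmentation is an
   identity square, by uniqueness of cospan fillers; this gives unitality.

   Evaluating simplices of S(D) of dimension 1, 2, 2, 3 at 01, 01 >-> 02,
   02 ->> 12 and the square with top 02 >-> 03 and left side 02 ->> 12 gives the
   counit PS(D) -> D, bijective by the description through strings.  The unit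
   X -> SP(X) sends x to the diagram of its faces of dimension 1, 2, 3; a map of
   2-Segal sets that is bijective in dimensions 0, 1, 2 is an isomorphism, and in
   these dimensions the counit of P(X) inverts the unit. *)

(** * Triangulations and ears *)

Lemma crossingP n (c d : 'I_n.+1 * 'I_n.+1) :
  reflect ((c.1 < d.1 /\ d.1 < c.2 /\ c.2 < d.2) \/
           (d.1 < c.1 /\ c.1 < d.2 /\ d.2 < c.2)) (crossing c d).
Proof.
apply: (iffP orP) => -[h|h]; [left|right|left|right]; move: h.
- by case/and3P.
- by case/and3P.
- by case=> -> [-> ->].
- by case=> -> [-> ->].
Qed.

(** Maximality can be tested on one chord at a time: no chord crosses itself, so adding to [E] a
    chord that crosses no member of [E] keeps the set non-crossing. *)
Lemma triangulationP n (E : {set 'I_n.+1 * 'I_n.+1}) :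
  triangulation E <->
  [/\ forall c, c \in E -> c.1 < c.2,
      forall c d, c \in E -> d \in E -> ~~ crossing c d
    & forall c : 'I_n.+1 * 'I_n.+1, c.1 < c.2 ->
        (forall d, d \in E -> ~~ crossing c d) -> c \in E].
Proof.
split=> [/maxsetP[/andP[/forall_inP Elt /forall_inP Enc] Emax]|[Elt Enc Emax]].
  split=> // [c d cE dE|c clt cE]; first by have /forall_inP := Enc c cE; apply.
  suff nc : noncrossing (c |: E) by rewrite -(Emax _ nc (finset.subsetUr _ _)) setU11.
  have cc : ~~ crossing c c by apply/negP => /crossingP; lia.
  apply/andP; split; apply/forall_inP => d /setU1P[->|dE] //; first exact: Elt.
    by apply/forall_inP => d' /setU1P[->|/cE].
  apply/forall_inP => d' /setU1P[->|d'E]; last by have /forall_inP := Enc d dE; apply.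
  by have := cE d dE; apply: contra => /crossingP h; apply/crossingP; lia.
apply/maxsetP; split.
  apply/andP; split; apply/forall_inP => // c cE.
  by apply/forall_inP => d dE; apply: Enc.
move=> B /andP[/forall_inP Blt /forall_inP Bnc] sub.
apply/eqP; rewrite finset.eqEsubset sub andbT; apply/fintype.subsetP => c cB.
apply: Emax; first exact: Blt.
move=> d /(fintype.subsetP sub) dB.
by have /forall_inP := Bnc c cB; apply.
Qed.

Lemma triangulation_exists n : exists E : {set 'I_n.+1 * 'I_n.+1}, triangulation E.
Proof.
have [|E ? _] := @maxset_exists _ (@noncrossing n) finset.set0; last by exists E.
by apply/andP; split; apply/forall_inP => c; rewrite inE.
Qed.

Lemma ear_subproof n (i : 'I_n.+1) (k : 'I_3) : i + k < n.+3.
Proof. by have := ltn_ord i; have := ltn_ord k; lia. Qed.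

Lemma ear_homo n (i : 'I_n.+1) :
  {homo (fun k : 'I_3 => Ordinal (ear_subproof i k)) : j k / j <= k}.
Proof. by move=> j k; rewrite /= leq_add2l. Qed.

Definition ear n (i : 'I_n.+1) : mono 2 n.+2 := Mono (ear_homo i).

Definition ear_chord n (i : 'I_n.+1) : 'I_n.+3 * 'I_n.+3 :=
  (Ordinal (ear_subproof i (@Ordinal 3 0 isT)), Ordinal (ear_subproof i (@Ordinal 3 2 isT))).

(** The polygon without the vertex [i.+1], relabelled along the coface. Chords ending at [i.+1] are
    lost, and [ear_chord i], if present, becomes the side from [i] to [i.+1]. *)
Definition cut_ear n (i : 'I_n.+2) (E : {set 'I_n.+4 * 'I_n.+4}) :
    {set 'I_n.+3 * 'I_n.+3} :=
  finset (fun c => (coface n.+2 i.+1 c.1, coface n.+2 i.+1 c.2) \in E).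

(** Take a shortest chord [(a, b)] of [E] among those of length at least 2. A chord crossing
    [(a, a+2)] ends at [a+1]; if it lies in [E], it either crosses [(a, b)] or is a shorter chord of
    length at least 2. Hence [(a, a+2)] is in [E] by maximality. *)
Lemma ear_exists n (E : {set 'I_n.+3 * 'I_n.+3}) :
  triangulation E -> exists i : 'I_n.+1, ear_chord i \in E.
Proof.
move=> /triangulationP[Elt Enc Emax].
(* The side [(0, n+2)] crosses nothing, so it lies in [E] and makes the search for a shortest chord
   non-empty. *)
have h0 : ((ord0, ord_max) : 'I_n.+3 * 'I_n.+3) \in E.
  apply: Emax => //= d dE; apply/negP => /crossingP /=.
  by have := ltn_ord d.1; have := ltn_ord d.2; lia.
pose good := [pred c : 'I_n.+3 * 'I_n.+3 | (c \in E) && (c.1.+2 <= c.2)].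
have g0 : good (ord0, ord_max) by rewrite inE h0.
have [c /andP[cE clen] cmin] := @arg_minnP _ _ good (fun c => c.2 - c.1) g0.
case: c cE clen cmin => a b /= abE ablen abmin.
have an : a < n.+1 by have := ltn_ord b; lia.
exists (Ordinal an).
apply: Emax => /= [|[d1 d2] dE]; first lia.
apply/negP => /crossingP /= x.
have := Enc _ _ abE dE => /negP nx.
have /= dlt := Elt _ dE.
have [dl|dl] := leqP d1.+2 d2; last lia.
have := abmin (d1, d2); rewrite /= dE dl => /(_ isT) ?.
by apply: nx; apply/crossingP => /=; lia.
Qed.

Lemma coface_preim n c (k : 'I_n.+2) : c <= n.+1 -> k <> c :> nat ->
  exists k', coface n c k' = k.
Proof.
move=> cn ne; have hk : unbump c k < n.+1.
  by have := ltn_ord k; rewrite /unbump; lia.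
by exists (Ordinal hk); apply: val_inj; rewrite /= /bump /unbump; lia.
Qed.

Section CutEar.
Variables (n : nat) (i : 'I_n.+2) (E : {set 'I_n.+4 * 'I_n.+4}).
Hypotheses (TE : triangulation E) (iE : ear_chord i \in E).

Lemma side_in (c : 'I_n.+4 * 'I_n.+4) : c.2 = c.1.+1 :> nat -> c \in E.
Proof.
have /triangulationP[Elt Enc Emax] := TE => e.
by apply: Emax => [|d dE]; [lia|apply/negP => /crossingP; lia].
Qed.

(** Any chord at the tip [i.+1] other than the two adjacent sides would cross [ear_chord i]. *)
Lemma ear_tip (c : 'I_n.+4 * 'I_n.+4) : c \in E ->
  (c.1 = i.+1 :> nat -> c.2 = i.+2 :> nat) /\ (c.2 = i.+1 :> nat -> c.1 = i :> nat).
Proof.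
have /triangulationP[Elt Enc Emax] := TE; case: c => [c1 c2] cE.
have := Enc _ _ cE iE => /negP nx; have /= clt := Elt _ cE.
by split=> /= e; apply: contrapT => ne; apply: nx; apply/crossingP => /=; lia.
Qed.

(** For maximality, a chord crossing nothing in the smaller polygon is compared with every chord [d]
    of [E]. By [ear_tip], a chord at the tip is a side and crosses nothing; every other [d] comes
    from the smaller polygon. *)
Lemma cut_ear_triangulation : triangulation (cut_ear i E).
Proof.
have /triangulationP[Elt Enc Emax] := TE.
have bb (j k : nat) : (bump i.+1 j < bump i.+1 k) = (j < k) by rewrite !ltnNge leq_bump2.
apply/triangulationP; split=> [c|c d|c clt cE].
- by rewrite inE => /Elt; rewrite /= bb.
- rewrite !inE => cE dE; have := Enc _ _ cE dE; apply: contra => /crossingP x.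
  by apply/crossingP; rewrite /= !bb.
rewrite inE; apply: Emax => /= [|d dE]; first by rewrite bb.
case: d dE => [d1 d2] dE; have /= [p1 p2] := ear_tip dE.
have [e1|n1] := pselect (d1 = i.+1 :> nat).
  by have := p1 e1 => ?; apply/negP => /crossingP; rewrite /= /bump; lia.
have [e2|n2] := pselect (d2 = i.+1 :> nat).
  by have := p2 e2 => ?; apply/negP => /crossingP; rewrite /= /bump; lia.
have i1 : i.+1 <= n.+3 by have := ltn_ord i; lia.
have [k1 e1] := coface_preim i1 n1; have [k2 e2] := coface_preim i1 n2.
have kE : (k1, k2) \in cut_ear i E by rewrite inE e1 e2.
have := cE _ kE; apply: contra => /crossingP x; apply/crossingP.
by move: x; rewrite -e1 -e2 /= !bb.
Qed.

Lemma ear_triangle (a b : 'I_3) : (a < b)%N -> (ear i a, ear i b) \in E.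
Proof.
move=> ab; have [e|e] := eqVneq (b : nat) a.+1; first by apply: side_in => /=; lia.
move: iE; congr (_ \in E); congr pair; apply: val_inj => /=; have := ltn_ord b; lia.
Qed.

Lemma cut_ear_triangle (t : mono 2 n.+2) :
  (forall a b : 'I_3, (a < b)%N -> (t a, t b) \in cut_ear i E) <->
  (forall a b : 'I_3, (a < b)%N ->
     (mono_comp (coface n.+2 i.+1) t a, mono_comp (coface n.+2 i.+1) t b) \in E).
Proof. by split=> h a b /h; rewrite inE. Qed.

Lemma triangle_cases (t : mono 2 n.+3) :
  (forall a b : 'I_3, (a < b)%N -> (t a, t b) \in E) ->
  t = ear i \/ exists t', t = mono_comp (coface n.+2 i.+1) t'.
Proof.
move=> tE; have [|no] := pselect (exists a, t a = i.+1 :> nat); last first.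
  right; have h a : exists k', coface n.+2 i.+1 k' = t a.
    by apply: coface_preim => [|e]; [have := ltn_ord i; lia|apply: no; exists a].
  have [f hf] := choice h.
  have fm : {homo f : j k / j <= k}.
    by move=> j k jk; rewrite -(leq_bump2 i.+1); have := mono_homo t jk; rewrite -!hf.
  by exists (Mono fm); apply: mono_ext => a; rewrite /= -hf.
case=> a ta; left.
have E01 := tE (@Ordinal 3 0 isT) (@Ordinal 3 1 isT) isT.
have E12 := tE (@Ordinal 3 1 isT) (@Ordinal 3 2 isT) isT.
have E02 := tE (@Ordinal 3 0 isT) (@Ordinal 3 2 isT) isT.
have /triangulationP[Elt _ _] := TE.
have := Elt _ E01; have := Elt _ E12; have := ear_tip E01; have := ear_tip E12.
have := ear_tip E02; rewrite /= => -[p1 p2] [p3 p4] [p5 p6] l1 l2.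
suff [q0 q1 q2] : [/\ t (@Ordinal 3 0 isT) = i :> nat,
    t (@Ordinal 3 1 isT) = i.+1 :> nat & t (@Ordinal 3 2 isT) = i.+2 :> nat].
  by apply: mono_ext => -[[|[|[|k]]] //= h]; rewrite (bool_irrelevance h isT); lia.
have [e|[e|e]] : t (@Ordinal 3 0 isT) = i.+1 :> nat \/ t (@Ordinal 3 1 isT) = i.+1 :> nat
    \/ t (@Ordinal 3 2 isT) = i.+1 :> nat.
- case: a ta => [[|[|[|k]]] //= h]; rewrite (bool_irrelevance h isT); tauto.
- by have := p1 e; have := p5 e; lia.
- by have := p6 e; have := p3 e; split.
- by have := p2 e; have := p4 e; lia.
Qed.
End CutEar.

Lemma ear_ind (P : forall n, {set 'I_n.+3 * 'I_n.+3} -> Prop) :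
  (forall E : {set 'I_3 * 'I_3}, triangulation E -> P 0 E) ->
  (forall n (E : {set 'I_n.+4 * 'I_n.+4}) (i : 'I_n.+2), triangulation E ->
     ear_chord i \in E -> P n (cut_ear i E) -> P n.+1 E) ->
  forall n (E : {set 'I_n.+3 * 'I_n.+3}), triangulation E -> P n E.
Proof.
move=> P0 PS; elim=> [|n IH] E TE; first exact: P0.
have [i iE] := ear_exists TE.
exact/(PS n E i TE iE)/IH/cut_ear_triangulation.
Qed.

Lemma triangulation2 (E : {set 'I_3 * 'I_3}) (c : 'I_3 * 'I_3) :
  triangulation E -> c.1 < c.2 -> c \in E.
Proof.
case: c => [c1 c2] /triangulationP[Elt Enc Emax] clt.
apply: Emax => // -[d1 d2] dE; have /= dlt := Elt _ dE; apply/negP => /crossingP /=.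
by move: clt; have := ltn_ord d2; have := ltn_ord c2; rewrite /=; lia.
Qed.

Lemma triangle2 (E : {set 'I_3 * 'I_3}) : triangulation E -> forall t : mono 2 2,
  (forall a b : 'I_3, (a < b)%N -> (t a, t b) \in E) <-> t = mono_id 2.
Proof.
move=> TE t; split=> [tE|->] => [|a b ab]; last exact: triangulation2.
have /triangulationP[Elt _ _] := TE.
have := Elt _ (tE (@Ordinal 3 0 isT) (@Ordinal 3 1 isT) isT).
have := Elt _ (tE (@Ordinal 3 1 isT) (@Ordinal 3 2 isT) isT) => /= h1 h2.
have := ltn_ord (t (@Ordinal 3 2 isT)) => h3.
by apply: mono_ext => -[[|[|[|k]]] //= h]; rewrite (bool_irrelevance h isT); lia.
Qed.

(** Used when an ear is glued on: the value of a simplex on the base of the ear is read off from a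
    triangle on the other side of the base. *)
Lemma edge_in_triangle n (E : {set 'I_n.+3 * 'I_n.+3}) : triangulation E ->
  forall u : mono 1 n.+2, (u ord0, u ord_max) \in E ->
  exists (t : triangle E) (a : 'I_3), mono_comp (sval t) (coface 1 a) = u.
Proof.
move: n E; apply: ear_ind => [E TE u uE|n E i TE iE IH u uE].
  have idE := (triangle2 TE (mono_id 2)).2 erefl.
  exists (exist _ _ idE) => /=.
  have /triangulationP[Elt _ _] := TE; have := Elt _ uE => /= ult.
  have := ltn_ord (u ord_max) => ub.
  (* The vertices of the triangle sum to 3, so this is the vertex opposite to the edge [u]. *)
  have ha : 3 - u ord0 - u ord_max < 3 by lia.
  exists (Ordinal ha); apply: mono_ext => -[[|[|k]] //= h].
    by rewrite (_ : Ordinal h = ord0) /bump; [lia|apply: val_inj].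
  by rewrite (_ : Ordinal h = ord_max) /bump; [lia|apply: val_inj].
have [u1|u1] := pselect (u ord0 = i.+1 :> nat).
  have u2 := (ear_tip TE iE uE).1 u1.
  exists (exist _ _ (ear_triangle TE iE)), (@Ordinal 3 0 isT).
  apply: mono_ext => -[[|[|k]] //= h].
    by rewrite (_ : Ordinal h = ord0) /bump; [lia|apply: val_inj].
  by rewrite (_ : Ordinal h = ord_max) /bump; [move: u2 => /=; lia|apply: val_inj].
have [u2|u2] := pselect (u ord_max = i.+1 :> nat).
  have u3 := (ear_tip TE iE uE).2 u2.
  exists (exist _ _ (ear_triangle TE iE)), (@Ordinal 3 2 isT).
  apply: mono_ext => -[[|[|k]] //= h].
    by rewrite (_ : Ordinal h = ord0) /bump; [move: u3 => /=; lia|apply: val_inj].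
  by rewrite (_ : Ordinal h = ord_max) /bump; [move: u2 => /=; lia|apply: val_inj].
have h (a : 'I_2) : exists k', coface n.+2 i.+1 k' = u a.
  apply: coface_preim; first by have := ltn_ord i; lia.
  case: a => [[|[|k]] //= h].
    by rewrite (_ : Ordinal h = ord0) //; apply: val_inj.
  by rewrite (_ : Ordinal h = ord_max) //; apply: val_inj.
have [f hf] := choice h.
have fm : {homo f : j k / j <= k}.
  by move=> j k jk; rewrite -(leq_bump2 i.+1); have := mono_homo u jk; rewrite -!hf.
have [|[t tE] [a /= ta]] := IH (Mono fm); first by rewrite inE; move: uE; rewrite -!hf.
exists (exist _ _ ((cut_ear_triangle i E t).1 tE)), a => /=.
apply: mono_ext => b; have := congr1 (fun v : mono 1 _ => v b) ta => /= e.
by rewrite e; have := hf b => /(congr1 val) /= <-.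
Qed.

(** * The 2-Segal condition from ear squares *)

Section TwoSegalOfEars.
Variable X : sset.

Hypothesis ear_inj : forall n (i : 'I_n.+1) (x y : X n.+2),
  face i.+1 x = face i.+1 y -> act (ear i) x = act (ear i) y -> x = y.
Hypothesis ear_fill : forall n (i : 'I_n.+1) (y : X n.+1) (z : X 2),
  act (edge i) y = face 1 z ->
  exists x : X n.+2, face i.+1 x = y /\ act (ear i) x = z.

Lemma segal_inj_of_ears n (E : {set 'I_n.+3 * 'I_n.+3}) : triangulation E ->
  forall x y : X n.+2, segal_map (E := E) x = segal_map y -> x = y.
Proof.
move: n E; apply: ear_ind => [E TE x y exy|n E i TE iE IH x y exy].
  have := congr1 (fun w => w (exist _ _ ((triangle2 TE (mono_id 2)).2 erefl))) exy.
  by rewrite /segal_map /= !act_id.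
apply: (@ear_inj _ i); last first.
  exact: (congr1 (fun w => w (exist _ _ (ear_triangle TE iE))) exy).
apply: IH; apply: functional_extensionality_dep => -[t tE].
have := congr1 (fun w => w (exist _ _ ((cut_ear_triangle i E t).1 tE))) exy.
by rewrite /segal_map /= !act_comp.
Qed.

Lemma segal_surj_of_ears n (E : {set 'I_n.+3 * 'I_n.+3}) : triangulation E ->
  forall w, @segal_target X n.+2 E w -> exists x, segal_map x = w.
Proof.
move: n E; apply: ear_ind => [E TE w wE|n E i TE iE IH w wE].
  exists (w (exist _ _ ((triangle2 TE (mono_id 2)).2 erefl))).
  apply: functional_extensionality_dep => -[t tE]; rewrite /segal_map /=.
  have e := (triangle2 TE t).1 tE; subst t; rewrite act_id; congr w.
  by congr exist; apply: Prop_irrelevance.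
pose lift (t : triangle (cut_ear i E)) : triangle E :=
  exist _ _ ((cut_ear_triangle i E (sval t)).1 (svalP t)).
pose e : triangle E := exist _ _ (ear_triangle TE iE).
have [|y yw] := IH (fun t => w (lift t)).
  move=> t t' a b h; apply: wE; apply: mono_ext => c /=.
  by have := congr1 (fun v : mono 1 _ => val (v c)) h => /= ->.
have cE : (edge i ord0, edge i ord_max) \in cut_ear i E.
  rewrite inE; suff -> : (coface n.+2 i.+1 (edge i ord0), coface n.+2 i.+1 (edge i ord_max)) = ear_chord i by [].
  congr pair; apply: val_inj => /=;
  rewrite /bump /=; lia.
(* The base of the ear is an edge of a triangle [t] of the smaller polygon; compatibility of [w]
   between [t] and the ear shows that [y] and [w e] agree on it. *)
have [t [a ta]] := edge_in_triangle (cut_ear_triangulation TE iE) cE.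
have [|x [xy xe]] := @ear_fill _ i y (w e).
  have yt : segal_map y t = w (lift t) by rewrite yw.
  rewrite -ta act_comp -[act (sval t) y]/(segal_map y t) yt.
  apply: (wE _ _ a (@Ordinal 3 1 isT)); apply: mono_ext => c.
  have := congr1 (fun v : mono 1 _ => val (v c)) ta => /= ->.
  by have := ltn_ord c; rewrite /bump; lia.
exists x; apply: functional_extensionality_dep => -[t0 t0E].
rewrite /segal_map /=.
have [h|[t' h]] := triangle_cases TE iE t0E; subst t0.
  by rewrite xe; congr w; congr exist; apply: Prop_irrelevance.
rewrite act_comp.
rewrite -[act (coface _ _) x]/(face i.+1 x) xy.
have tE' := (cut_ear_triangle i E t').2 t0E.
have := congr1 (fun v => v (exist _ t' tE')) yw; rewrite /segal_map /= => ->.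
by congr w; congr exist; apply: Prop_irrelevance.
Qed.

Lemma two_segal_of_ears : two_segal X.
Proof.
case=> [|[|[|n]]] E // _ TE; split.
- move=> x _ t t' a b e; rewrite /segal_map /face -!act_comp; congr (act _ x).
  by apply: e.
- by move=> x y _ _; apply: segal_inj_of_ears.
by move=> w /(segal_surj_of_ears TE)[x xw]; exists x.
Qed.

End TwoSegalOfEars.

(** For [n >= 3] and any triangulation, [n]-simplices are families of 2-simplices that agree on
    common edges, so bijectivity in dimensions 1 and 2 propagates upwards. *)
Lemma smap_bij_of_low (X Y : sset) (f : smap X Y) :
  two_segal X -> two_segal Y ->
  (forall n, n <= 2 -> bijective (f n)) -> forall n, bijective (f n).
Proof.
move=> XS YS low n; have [/low //|n3] := leqP n 2.
have [E TE] := triangulation_exists n.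
have [_ injX surX] := XS _ _ n3 TE; have [tgtY injY surY] := YS _ _ n3 TE.
have [g gK fK] := low 2 isT; have [g1 g1K _] := low 1 isT.
have inj : injective (f n).
  move=> x y e; apply: injX; rewrite ?inE //.
  apply: functional_extensionality_dep => t; apply: (can_inj gK).
  by rewrite /segal_map !smap_nat e.
suff sur y : exists x, f n x = y.
  have [h hK] := choice sur.
  by exists h => // x; apply: inj; rewrite hK.
have yE := tgtY y I.
(* The family of [y] is pulled back along the inverse [g] of [f 2]; it stays compatible because
   [f 1] is injective. *)
have [|x _ hx] := surX (fun t => g (segal_map y t)).
  move=> t t' a b /yE e; apply: (can_inj g1K).
  by rewrite /face !smap_nat !fK.
exists x; apply: injY; rewrite ?inE //; apply: functional_extensionality_dep => t.
by rewrite /segal_map -smap_nat -[act (sval t) x]/(segal_map x t) hx fK.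
Qed.

(** * Squares in stable double categories *)

(* Composability proofs are hidden in a relation, so that equations between
   composites can be rewritten freely. *)
Definition composes O M (C : cat_on O M) (f g h : M) : Prop :=
  exists e : tgt C f = src C g, mcomp e = h.

Section Composes.
Variables (O M : Type) (C : cat_on O M).

Lemma composes_ex f g : tgt C f = src C g -> exists h, composes C f g h.
Proof. by move=> e; exists (mcomp e), e. Qed.

Lemma composes_mcomp f g (e : tgt C f = src C g) : composes C f g (mcomp e).
Proof. by exists e. Qed.

Lemma composes_uniq f g h h' : composes C f g h -> composes C f g h' -> h = h'.
Proof. by move=> [e <-] [e' <-]; congr mcomp; apply: Prop_irrelevance. Qed.

Lemma composes_mcompE f g h (e : tgt C f = src C g) : composes C f g h -> mcomp e = h.
Proof. exact/composes_uniq/composes_mcomp. Qed.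

Lemma composes_eq f g h : composes C f g h -> tgt C f = src C g.
Proof. by case. Qed.
Lemma composes_src f g h : composes C f g h -> src C h = src C f.
Proof. by case=> e <-; apply: src_mcomp. Qed.
Lemma composes_tgt f g h : composes C f g h -> tgt C h = tgt C g.
Proof. by case=> e <-; apply: tgt_mcomp. Qed.

Lemma composes_idl f a : src C f = a -> composes C (idm C a) f f.
Proof.
move=> <-; have e : tgt C (idm C (src C f)) = src C f by rewrite tgt_idm.
by exists e; apply: mcomp_idl.
Qed.
Lemma composes_idr f a : tgt C f = a -> composes C f (idm C a) f.
Proof.
move=> <-; have e : tgt C f = src C (idm C (tgt C f)) by rewrite src_idm.
by exists e; apply: mcomp_idr.
Qed.

Lemma composesA f g h fg gh k :
  composes C f g fg -> composes C g h gh -> composes C fg h k -> composes C f gh k.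
Proof.
move=> [e1 <-] [e2 <-] [e3 <-].
have e4 : tgt C f = src C (mcomp e2) by rewrite src_mcomp.
by exists e4; rewrite (mcompA e3 e4).
Qed.

(** Total composition, with junk value [f] on non-composable pairs, so that strings can be composed
    recursively before composability is known. *)
Definition tcomp f g : M := if pselect (tgt C f = src C g) is left e then mcomp e else f.

Lemma tcompP f g : tgt C f = src C g -> composes C f g (tcomp f g).
Proof. by rewrite /tcomp => e; case: pselect => // e'; apply: composes_mcomp. Qed.

End Composes.

Lemma functor_composes O M O' M' (C : cat_on O M) (C' : cat_on O' M') fo fm f g h :
  is_functor C C' fo fm -> composes C f g h -> composes C' (fm f) (fm g) (fm h).
Proof.
move=> F [e <-]; have e' : tgt C' (fm f) = src C' (fm g).
  by rewrite (fun_tgt F) (fun_src F) e.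
by exists e'; rewrite (fun_mcomp F e e').
Qed.

Lemma is_functor_of_composes O M O' M' (C : cat_on O M) (C' : cat_on O' M') fo fm :
  (forall f, src C' (fm f) = fo (src C f)) -> (forall f, tgt C' (fm f) = fo (tgt C f)) ->
  (forall a, fm (idm C a) = idm C' (fo a)) ->
  (forall f g h, composes C f g h -> composes C' (fm f) (fm g) (fm h)) ->
  is_functor C C' fo fm.
Proof.
move=> fs ft fi fc; split=> // f g e e'.
exact/esym/composes_mcompE/fc/composes_mcomp.
Qed.

Section Corners.
Variables (D : dcat) (s : Sq D).

Lemma sq_tl : src (ver0 D) (src (hor1 D) s) = src (hor0 D) (src (ver1 D) s).
Proof. by rewrite (fun_src (src_ver_functor D)). Qed.
Lemma sq_tr : src (ver0 D) (tgt (hor1 D) s) = tgt (hor0 D) (src (ver1 D) s).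
Proof. by rewrite (fun_tgt (src_ver_functor D)). Qed.
Lemma sq_bl : tgt (ver0 D) (src (hor1 D) s) = src (hor0 D) (tgt (ver1 D) s).
Proof. by rewrite (fun_src (tgt_ver_functor D)). Qed.
Lemma sq_br : tgt (ver0 D) (tgt (hor1 D) s) = tgt (hor0 D) (tgt (ver1 D) s).
Proof. by rewrite (fun_tgt (tgt_ver_functor D)). Qed.
End Corners.

Section Stable.
Variables (D : aug_dcat) (st : stable D).

Local Notation H0 := (hor0 D).
Local Notation V0 := (ver0 D).
Local Notation H1 := (hor1 D).
Local Notation V1 := (ver1 D).

Lemma span_uniq s t : src H1 s = src H1 t -> src V1 s = src V1 t -> s = t.
Proof. by move=> h v; case: st => [[_ i _] _]; apply: i; rewrite ?inE ?h ?v. Qed.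
Lemma cospan_uniq s t : tgt H1 s = tgt H1 t -> tgt V1 s = tgt V1 t -> s = t.
Proof. by move=> h v; case: st => [_ [_ i _]]; apply: i; rewrite ?inE ?h ?v. Qed.
Lemma span_fill v h : src V0 v = src H0 h -> exists s, src H1 s = v /\ src V1 s = h.
Proof.
by move=> e; case: st => [[_ _ /(_ (v, h))]] + _; case=> // s _ [<- <-]; exists s.
Qed.
Lemma cospan_fill v h : tgt V0 v = tgt H0 h -> exists s, tgt H1 s = v /\ tgt V1 s = h.
Proof.
by move=> e; case: st => [_ [_ _ /(_ (v, h))]]; case=> // s _ [<- <-]; exists s.
Qed.

(** The filler of the span with left side [v] and top [h]; the identity square is a junk value for
    pairs with different sources. *)
Definition push v h : Sq D :=
  if pselect (src V0 v = src H0 h) is left e then projT1 (cid (span_fill e)) else idm H1 v.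

Lemma pushP v h : src V0 v = src H0 h -> src H1 (push v h) = v /\ src V1 (push v h) = h.
Proof. by rewrite /push => e; case: pselect => // e'; case: cid. Qed.

Lemma pushE v h s : src H1 s = v -> src V1 s = h -> push v h = s.
Proof.
move=> sv sh; have e : src V0 v = src H0 h by rewrite -sv -sh sq_tl.
by have [pv ph] := pushP e; apply: span_uniq; rewrite ?pv ?ph.
Qed.

Lemma push_idl v : push v (idm H0 (src V0 v)) = idm H1 v.
Proof. by apply: pushE; rewrite ?src_idm // (fun_idm (src_ver_functor D)). Qed.

Lemma push_idr h : push (idm V0 (src H0 h)) h = idm V1 h.
Proof. by apply: pushE; rewrite ?src_idm // (fun_idm (src_hor_functor D)). Qed.

(** The pasted square has left side [v] and top [k], and a square is determined by these. The
    identities between the cells of a diagram below come from such pastings. *)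
Lemma push_hcomp v h h' k s t :
  src H1 s = v -> src V1 s = h -> tgt H1 s = src H1 t -> src V1 t = h' ->
  composes H0 h h' k -> composes H1 s t (push v k).
Proof.
move=> sv sh st' th hc; have [c cc] := composes_ex st'.
rewrite (@pushE _ _ c) //; first by rewrite (composes_src cc).
have := functor_composes (src_ver_functor D) cc; rewrite sh th => hc'.
exact: composes_uniq hc' hc.
Qed.

Lemma push_vcomp v v' w h s t :
  src H1 s = v -> src V1 s = h -> tgt V1 s = src V1 t -> src H1 t = v' ->
  composes V0 v v' w -> composes V1 s t (push w h).
Proof.
move=> sv sh st' tv vc; have [c cc] := composes_ex st'.
rewrite (@pushE _ _ c) //; last by rewrite (composes_src cc).
have := functor_composes (src_hor_functor D) cc; rewrite sv tv => vc'.
exact: composes_uniq vc' vc.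
Qed.

End Stable.

Section AugVer.
Variable D : aug_dcat.

(** The unique vertical morphism from [d] into the augmentation. *)
Definition aver (d : Ob D) : Ver D := projT1 (cid (aug_ver d)).

Lemma aver_src d : src (ver0 D) (aver d) = d.
Proof. by rewrite /aver; case: cid => v [[]]. Qed.
Lemma aver_tgt d : aug (tgt (ver0 D) (aver d)).
Proof. by rewrite /aver; case: cid => v [[]]. Qed.
Lemma averE v : aug (tgt (ver0 D) v) -> v = aver (src (ver0 D) v).
Proof.
move=> h; have [u [_ uu]] := aug_ver (src (ver0 D) v).
apply: (etrans (esym (uu v _))) (uu _ _) => //.
by rewrite aver_src; split=> //; apply: aver_tgt.
Qed.
Lemma aver_id a : aug a -> aver a = idm (ver0 D) a.
Proof. by move=> h; rewrite [RHS]averE ?src_idm // tgt_idm. Qed.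

Lemma aver_composes v d :
  src (ver0 D) v = d -> composes (ver0 D) v (aver (tgt (ver0 D) v)) (aver d).
Proof.
move=> vd; have [|w vw] := @composes_ex _ _ (ver0 D) v (aver (tgt (ver0 D) v)).
  by rewrite aver_src.
suff e : w = aver d by rewrite -e.
rewrite [LHS]averE; first by rewrite (composes_src vw) vd.
rewrite (composes_tgt vw); exact: aver_tgt.
Qed.

Lemma aug_hor_inj f g : aug (src (hor0 D) f) -> aug (src (hor0 D) g) ->
  tgt (hor0 D) f = tgt (hor0 D) g -> f = g.
Proof.
move=> hf hg e; have [u [_ uu]] := aug_hor (tgt (hor0 D) g).
exact: (etrans (esym (uu f _)) (uu g _)).
Qed.
End AugVer.

(** * Diagrams from strings of horizontal morphisms *)

Section StringFunctor.
Variables (D : aug_dcat) (st : stable D).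

Local Notation H0 := (hor0 D).
Local Notation V0 := (ver0 D).
Local Notation H1 := (hor1 D).
Local Notation V1 := (ver1 D).
Local Notation push := (push st).

Variables (o : nat -> Ob D) (h : nat -> Hor D).
Hypotheses (h_src : forall l, src H0 (h l) = o l)
  (h_tgt : forall l, tgt H0 (h l) = o l.+1) (o0 : aug (o 0)).

(** The composite of [d] consecutive steps of the string from [o i]; indexing by length makes the
    recursion structural, and [row] below is indexed by endpoints. *)
Fixpoint run (i d : nat) : Hor D :=
  if d is d'.+1 then tcomp H0 (run i d') (h (i + d')) else idm H0 (o i).

Lemma run_ends i d : src H0 (run i d) = o i /\ tgt H0 (run i d) = o (i + d).
Proof.
elim: d => [|d [IHs IHt]] /=; first by rewrite src_idm tgt_idm addn0.
have c : composes H0 (run i d) (h (i + d)) (run i d.+1).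
  by apply: tcompP; rewrite IHt h_src.
by rewrite (composes_src c) (composes_tgt c) IHs h_tgt addnS.
Qed.

Lemma runS i d : composes H0 (run i d) (h (i + d)) (run i d.+1).
Proof. by apply: tcompP; rewrite h_src (run_ends i d).2. Qed.

Lemma runD i d e : composes H0 (run i d) (run (i + d) e) (run i (d + e)).
Proof.
elim: e => [|e IH] /=; first by rewrite addn0; apply: composes_idr; case: (run_ends i d).
rewrite addnS; apply: (composesA IH (runS _ _)).
by rewrite -addnA; apply: runS.
Qed.

Definition row i j := run i (j - i).

Lemma row_src i j : src H0 (row i j) = o i.
Proof. by case: (run_ends i (j - i)). Qed.
Lemma row_tgt i j : i <= j -> tgt H0 (row i j) = o j.
Proof. by move=> ij; have [_] := run_ends i (j - i); rewrite subnKC. Qed.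
Lemma row_id i : row i i = idm H0 (o i).
Proof. by rewrite /row subnn. Qed.
Lemma row_comp i j k : i <= j -> j <= k -> composes H0 (row i j) (row j k) (row i k).
Proof.
move=> ij jk; have := runD i (j - i) (k - j); rewrite subnKC //.
by rewrite /row; congr (composes _ _ _ (run _ _)); lia.
Qed.
Lemma row_step l : row l l.+1 = h l.
Proof.
rewrite /row subSnn; have := runS l 0; rewrite addn0 => c.
by apply: composes_uniq c _; apply: composes_idl; rewrite h_src.
Qed.

(* [corner i j] is the square (0, i, i, j), with right side [col i j : o j ->> ob i j];
   [strip i j k] is (0, i, j, k) and [flag i k j] is (i, k, k, j). *)
Definition corner i j := push (aver (o i)) (row i j).
Definition col i j := tgt H1 (corner i j).
Definition ob i j := tgt V0 (col i j).
Definition strip i j k := push (col i j) (row j k).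
Definition hr i j k := tgt V1 (strip i j k).
Definition flag i k j := push (aver (ob i k)) (hr i k j).
Definition vr i k j := tgt H1 (flag i k j).
Definition sq i k j l := push (vr i k j) (hr i j l).

Lemma cornerP i j : src H1 (corner i j) = aver (o i) /\ src V1 (corner i j) = row i j.
Proof. by apply: pushP; rewrite aver_src row_src. Qed.

Lemma col_src i j : i <= j -> src V0 (col i j) = o j.
Proof. by move=> ij; rewrite /col sq_tr (cornerP i j).2 row_tgt. Qed.

Lemma stripP i j k : i <= j -> src H1 (strip i j k) = col i j /\ src V1 (strip i j k) = row j k.
Proof. by move=> ij; apply: pushP; rewrite col_src // row_src. Qed.

Lemma corner_strip i j k : i <= j -> j <= k ->
  composes H1 (corner i j) (strip i j k) (corner i k).
Proof.
move=> ij jk; have [c1 c2] := cornerP i j; have [s1 s2] := stripP k ij.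
by apply: (push_hcomp _ c1 c2 _ s2); [rewrite s1|apply: row_comp].
Qed.

Lemma strip_tgt i j k : i <= j -> j <= k -> tgt H1 (strip i j k) = col i k.
Proof. by move=> ij jk; rewrite /col (composes_tgt (corner_strip ij jk)). Qed.

Lemma strip_comp i j k l : i <= j -> j <= k -> k <= l ->
  composes H1 (strip i j k) (strip i k l) (strip i j l).
Proof.
move=> ij jk kl; have [s1 s2] := stripP k ij; have [t1 t2] := stripP l (leq_trans ij jk).
by apply: (push_hcomp _ s1 s2 _ t2); [rewrite strip_tgt|apply: row_comp].
Qed.

Lemma strip_id i j : i <= j -> strip i j j = idm H1 (col i j).
Proof. by move=> ij; rewrite -push_idl /strip row_id col_src. Qed.

Lemma hr_src i j k : i <= j -> src H0 (hr i j k) = ob i j.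
Proof. by move=> ij; rewrite /hr -sq_bl (stripP k ij).1. Qed.
Lemma hr_tgt i j k : i <= j -> j <= k -> tgt H0 (hr i j k) = ob i k.
Proof. by move=> ij jk; rewrite /hr -sq_br strip_tgt. Qed.
Lemma hr_comp i j k l : i <= j -> j <= k -> k <= l ->
  composes H0 (hr i j k) (hr i k l) (hr i j l).
Proof.
by move=> ij jk kl; apply: (functor_composes (tgt_ver_functor D)); apply: strip_comp.
Qed.
Lemma hr_id i j : i <= j -> hr i j j = idm H0 (ob i j).
Proof. by move=> ij; rewrite /hr strip_id // (fun_idm (tgt_ver_functor D)). Qed.

(** The top of [corner i i] is an identity, so this is the identity square of [aver (o i)], and
    [ob i i] is the target of that morphism. *)
Lemma ob_aug i : aug (ob i i).
Proof.
rewrite /ob /col /corner row_id -{2}(aver_src (o i)) push_idl tgt_idm; exact: aver_tgt.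
Qed.

Lemma flagP i k j : i <= k -> src H1 (flag i k j) = aver (ob i k) /\ src V1 (flag i k j) = hr i k j.
Proof. by move=> ik; apply: pushP; rewrite aver_src hr_src. Qed.

Lemma vr_src i k j : i <= k -> k <= j -> src V0 (vr i k j) = ob i j.
Proof. by move=> ik kj; rewrite /vr sq_tr (flagP j ik).2 hr_tgt. Qed.

(** The left sides [col i k] and [aver (ob i k)] compose to a morphism from [o k] into the
    augmentation, which can only be [aver (o k)]. So the pasted square has the left side and top of
    [corner k j]. *)
Lemma strip_flag i k j : i <= k -> k <= j ->
  composes V1 (strip i k j) (flag i k j) (corner k j).
Proof.
move=> ik kj; have [s1 s2] := stripP j ik; have [f1 f2] := flagP j ik.
apply: (push_vcomp _ s1 s2 _ f1); first by rewrite f2.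
by apply: aver_composes; rewrite col_src.
Qed.

Lemma col_vr i k j : i <= k -> k <= j -> composes V0 (col i j) (vr i k j) (col k j).
Proof.
move=> ik kj; have := functor_composes (tgt_hor_functor D) (strip_flag ik kj).
by rewrite strip_tgt.
Qed.

Lemma vr_tgt i k j : i <= k -> k <= j -> tgt V0 (vr i k j) = ob k j.
Proof. by move=> ik kj; rewrite /ob (composes_tgt (col_vr ik kj)). Qed.

Lemma sqP i k j l : i <= k -> k <= j ->
  src H1 (sq i k j l) = vr i k j /\ src V1 (sq i k j l) = hr i j l.
Proof. by move=> ik kj; apply: pushP; rewrite vr_src // hr_src ?(leq_trans ik). Qed.

(** Pasting [strip i j l] on top of the square gives [strip k j l], and both have the same
    bottom. *)
Lemma sq_bot i k j l : i <= k -> k <= j -> tgt V1 (sq i k j l) = hr k j l.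
Proof.
move=> ik kj; have ij := leq_trans ik kj.
have [s1 s2] := stripP l ij; have [f1 f2] := sqP l ik kj.
suff c : composes V1 (strip i j l) (sq i k j l) (strip k j l) by rewrite -(composes_tgt c).
by apply: (push_vcomp _ s1 s2 _ f1); [rewrite f2|apply: col_vr].
Qed.

Lemma sq_right i k j l : i <= k -> k <= j -> j <= l -> tgt H1 (sq i k j l) = vr i k l.
Proof.
move=> ik kj jl; have [s1 s2] := flagP j ik; have [f1 f2] := sqP l ik kj.
suff c : composes H1 (flag i k j) (sq i k j l) (flag i k l) by rewrite -(composes_tgt c).
by apply: (push_hcomp _ s1 s2 _ f2); [rewrite f1|apply: hr_comp].
Qed.

(** Pasting [sq i k m j] on top of [flag k m j] gives [flag i m j]; the equation compares right
    sides. *)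
Lemma vr_comp i k m j : i <= k -> k <= m -> m <= j ->
  composes V0 (vr i k j) (vr k m j) (vr i m j).
Proof.
move=> ik km mj; have im := leq_trans ik km.
have [s1 s2] := sqP j ik km; have [f1 f2] := flagP j km.
rewrite -(@sq_right i k m j) //.
apply: (functor_composes (tgt_hor_functor D)).
apply: (push_vcomp _ s1 s2 _ f1); first by rewrite f2 sq_bot.
by rewrite -(vr_tgt ik km); apply: aver_composes; rewrite vr_src.
Qed.

Lemma vr_id i j : i <= j -> vr i i j = idm V0 (ob i j).
Proof.
move=> ij; rewrite /vr /flag (aver_id (ob_aug i)) -(hr_src j (leqnn i)) push_idr.
by rewrite (fun_idm (tgt_hor_functor D)) hr_tgt.
Qed.

Lemma sq_hcomp i k j l m : i <= k -> k <= j -> j <= l -> l <= m ->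
  composes H1 (sq i k j l) (sq i k l m) (sq i k j m).
Proof.
move=> ik kj jl lm; have [s1 s2] := sqP l ik kj; have [t1 t2] := sqP m ik (leq_trans kj jl).
apply: (push_hcomp _ s1 s2 _ t2); first by rewrite t1 sq_right.
by apply: hr_comp; rewrite ?(leq_trans ik).
Qed.

Lemma sq_vcomp i k m j l : i <= k -> k <= m -> m <= j ->
  composes V1 (sq i k j l) (sq k m j l) (sq i m j l).
Proof.
move=> ik km mj; have [s1 s2] := sqP l ik (leq_trans km mj); have [t1 t2] := sqP l km mj.
apply: (push_vcomp _ s1 s2 _ t1); last exact: vr_comp.
by rewrite t2 sq_bot // (leq_trans km).
Qed.

Lemma sq_hid i k j : i <= k -> k <= j -> sq i k j j = idm H1 (vr i k j).
Proof.
by move=> ik kj; rewrite /sq hr_id ?(leq_trans ik) // -(vr_src ik kj) push_idl.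
Qed.

Lemma sq_vid i j l : i <= j -> sq i i j l = idm V1 (hr i j l).
Proof. by move=> ij; rewrite /sq vr_id // -(hr_src l ij) push_idr. Qed.

(** As [o 0] lies in the augmentation, [aver (o 0)] is an identity. Hence so is each [col 0 j], and
    [strip 0 j k] is an identity square whose bottom is its top. *)
Lemma hr0 j k : j <= k -> hr 0 j k = row j k.
Proof.
move=> jk; have c0 i : col 0 i = idm V0 (o i).
  rewrite /col /corner (aver_id o0) -(row_src 0 i) push_idr.
  by rewrite (fun_idm (tgt_hor_functor D)) row_tgt.
rewrite /hr /strip c0 -(row_src j k) push_idr tgt_idm; exact: erefl.
Qed.

Lemma ob0 j : ob 0 j = o j.
Proof. by rewrite -(@hr_src 0 j j) // hr0 // row_src. Qed.

Definition string_dfunctor n : dfunctor (W n) D.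
Proof.
refine (@DFunctor (W n) D (fun a : w_ob n => ob (wo_i a) (wo_j a))
  (fun f : w_hor n => hr (wh_i f) (wh_j f) (wh_k f))
  (fun v : w_ver n => vr (wv_i v) (wv_k v) (wv_j v))
  (fun s : w_sq n => sq (ws_i s) (ws_k s) (ws_j s) (ws_l s)) _ _ _ _);
  apply: is_functor_of_composes => /=.
- by case=> i j k /= /andP[ij jk]; rewrite hr_src.
- by case=> i j k /= /andP[ij jk]; rewrite hr_tgt.
- by case=> i j /= ij; rewrite hr_id.
- case=> i j k f [i' k' l g] _ [e <-] /=; have [/= ei ek] := e; subst i' k'.
  by case/andP: f g {e} => ij jk /= /andP[_ kl]; apply: hr_comp.
- by case=> i k j /= /andP[ik kj]; rewrite vr_src.
- by case=> i k j /= /andP[ik kj]; rewrite vr_tgt.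
- by case=> i j /= ij; rewrite vr_id.
- case=> i k j f [k' m j' g] _ [e <-] /=; have [/= ek ej] := e; subst k' j'.
  by case/andP: f g {e} => ik kj /= /andP[km mj]; apply: vr_comp.
- by case=> i k j l /= /and3P[ik kj jl]; case: (sqP l ik kj).
- by case=> i k j l /= /and3P[ik kj jl]; rewrite sq_right.
- by case=> i k j /= /andP[ik kj]; rewrite sq_hid.
- case=> i k j l f [i' k' l' m g] _ [e <-] /=; have [/= ei ek el] := e; subst i' k' l'.
  by case/and3P: f g {e} => ik kj jl /= /and3P[_ _ lm]; apply: sq_hcomp.
- by case=> i k j l /= /and3P[ik kj jl]; case: (sqP l ik kj).
- by case=> i k j l /= /and3P[ik kj jl]; rewrite sq_bot.
- by case=> i j l /= /andP[ij jl]; rewrite sq_vid.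
- case=> i k j l f [k' m j' l' g] _ [e <-] /=; have [/= ek ej el] := e; subst k' j' l'.
  by case/and3P: f g {e} => ik kj jl /= /and3P[km mj _]; apply: sq_vcomp.
Defined.

Lemma string_aug n a : aug (a := W n) a -> aug (df_ob (string_dfunctor n) a).
Proof. by rewrite {1}/aug /= /w_aug /= => ->; apply: ob_aug. Qed.

Definition string_functor n : aug_dfunctor (W n) D := AugDFunctor (@string_aug n).

End StringFunctor.

(* Indices are truncated at [n], so that [hstep n l] is an identity for [l >= n]. *)
Lemma trunc_subproof n l : minn l n < n.+1.
Proof. by rewrite ltnS geq_minr. Qed.
Definition trunc n l : 'I_n.+1 := Ordinal (trunc_subproof n l).

Lemma hstep_subproof n l : (@ord0 n <= trunc n l <= trunc n l.+1)%N.
Proof. by rewrite /=; lia. Qed.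
Definition hstep n l : w_hor n := WHor (hstep_subproof n l).

Lemma obstep_subproof n l : (@ord0 n <= trunc n l)%N.
Proof. by []. Qed.
Definition obstep n l : w_ob n := WOb (obstep_subproof n l).

Lemma hstep_src n l : wh_src (hstep n l) = obstep n l.
Proof. exact: w_ob_ext. Qed.
Lemma hstep_tgt n l : wh_tgt (hstep n l) = obstep n l.+1.
Proof. exact: w_ob_ext. Qed.

Lemma string_exists (D : aug_dcat) (st : stable D) n (o : nat -> Ob D) (h : nat -> Hor D) :
  (forall l, src (hor0 D) (h l) = o l) -> (forall l, tgt (hor0 D) (h l) = o l.+1) ->
  aug (o 0) ->
  exists F : aug_dfunctor (W n) D,
    df_ob F (obstep n 0) = o 0 /\ forall l, l < n -> df_hor F (hstep n l) = h l.
Proof.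
move=> hs ht o0; exists (string_functor st hs ht n); split=> [|l ln] /=.
  by rewrite min0n ob0.
have -> : minn l n = l by lia.
have -> : minn l.+1 n = l.+1 by lia.
by rewrite hr0 // row_step.
Qed.

(** * A diagram is determined by its top row *)

Section StringUniq.
Variables (D : aug_dcat) (st : stable D) (n : nat).
Variables (F G : aug_dfunctor (W n) D).
Hypotheses (FG0 : df_ob F (obstep n 0) = df_ob G (obstep n 0))
  (FGh : forall l, l < n -> df_hor F (hstep n l) = df_hor G (hstep n l)).

Let sqF (E : aug_dfunctor (W n) D) := (fun_src (df_hor1 E), fun_tgt (df_hor1 E),
  fun_src (df_ver1 E), fun_tgt (df_ver1 E)).

Lemma string_uniq_ob (a : w_ob n) : wo_i a = 0 :> nat -> df_ob F a = df_ob G a.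
Proof.
case: a => i j ij /= i0.
have -> : WOb ij = obstep n j.
  by apply: w_ob_ext; apply: val_inj; rewrite //=; have := ltn_ord j; lia.
have := ltn_ord j; move: (j : nat) => l; rewrite ltnS => {i j ij i0}.
elim: l => // l IH ln.
have := congr1 (tgt (hor0 D)) (FGh ln).
by rewrite !(fun_tgt (df_hor0 _)) /= hstep_tgt.
Qed.

(** Induction on the length [c - b], splitting off the last step. *)
Lemma string_uniq_row (f : w_hor n) : wh_i f = 0 :> nat -> df_hor F f = df_hor G f.
Proof.
case: f => a b c abc /= a0.
have [m cm] := ubnP (c - b); elim: m c abc cm => // m IH c abc cm.
have [cb|cb] := leqP c b.
  have -> : WHor abc = idm (hor0 (W n)) (wh_src (WHor abc)).
    by apply: w_hor_ext => //; apply: val_inj => /=; lia.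
  by rewrite !(fun_idm (df_hor0 _)) string_uniq_ob.
have c1n : c.-1 < n.+1 by have := ltn_ord c; lia.
have abc1 : a <= b <= Ordinal c1n by rewrite /=; lia.
have [|h hh] := @composes_ex _ _ (hor0 (W n)) (WHor abc1) (hstep n c.-1).
  by apply: w_ob_ext; apply: val_inj => /=; lia.
have -> : WHor abc = h.
  case: hh => e' <-; apply: w_hor_ext; rewrite //=; apply: val_inj => /=.
  by have := ltn_ord c; lia.
have hF := functor_composes (df_hor0 F) hh; have := functor_composes (df_hor0 G) hh.
rewrite -IH /=; last by lia.
by rewrite -FGh; [move/(composes_uniq hF)|have := ltn_ord c; lia].
Qed.

Lemma aug_ver_eq (v : w_ver n) : wv_k v = wv_j v :> nat ->
  df_ob F (wv_src v) = df_ob G (wv_src v) -> df_ver F v = df_ver G v.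
Proof.
move=> kj e; have va : aug (a := W n) (wv_tgt v) by apply: val_inj.
have av (E : aug_dfunctor (W n) D) : df_ver E v = aver (df_ob E (wv_src v)).
  rewrite -[df_ob E _](fun_src (df_ver0 E)); apply: averE.
  by rewrite (fun_tgt (df_ver0 E)); apply: adf_aug.
by rewrite !av e.
Qed.

Lemma span_eq (s : w_sq n) : df_ver F (ws_sh s) = df_ver G (ws_sh s) ->
  df_hor F (ws_sv s) = df_hor G (ws_sv s) -> df_sq F s = df_sq G s.
Proof. by move=> v h; apply: (span_uniq st); rewrite !sqF. Qed.

(** [0j ->> kj] is the right side of the square with top [0k >-> 0j] and left side [0k ->> kk]. The
    latter ends in the augmentation, so its source determines its image. *)
Lemma string_uniq_ver0 (v : w_ver n) : wv_i v = 0 :> nat -> df_ver F v = df_ver G v.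
Proof.
case: v => i k j ikj /= i0; have /andP[ik kj] := ikj.
have ikk : i <= k <= k by rewrite ik leqnn.
have ikkj : [&& i <= k, k <= k & k <= j] by rewrite ik leqnn.
have -> : WVer ikj = ws_th (WSq ikkj) by apply: w_ver_ext.
have := congr1 (tgt (hor1 D)) (@span_eq (WSq ikkj) _ _); rewrite !sqF; apply.
  by apply: aug_ver_eq => //; apply: string_uniq_ob.
exact: string_uniq_row.
Qed.

(** [ij >-> ik] is the bottom of the square with top [0j >-> 0k] and left side [0j ->> ij], both
    already settled. *)
Lemma string_uniq_hor (f : w_hor n) : df_hor F f = df_hor G f.
Proof.
case: f => i j k ijk; have /andP[ij jk] := ijk.
have s : [&& @ord0 n <= i, i <= j & j <= k] by rewrite ij.
have -> : WHor ijk = ws_tv (WSq s) by apply: w_hor_ext.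
have := congr1 (tgt (ver1 D)) (@span_eq (WSq s) _ _); rewrite !sqF; apply.
  exact: string_uniq_ver0.
exact: string_uniq_row.
Qed.

Lemma string_uniq_ob' (a : w_ob n) : df_ob F a = df_ob G a.
Proof.
have := congr1 (src (hor0 D)) (string_uniq_hor (wh_id a)).
by rewrite !(fun_src (df_hor0 _)) (src_idm (hor0 (W n))).
Qed.

Lemma string_uniq_ver (v : w_ver n) : df_ver F v = df_ver G v.
Proof.
case: v => i k j ikj; have /andP[ik kj] := ikj.
have ikkj : [&& i <= k, k <= k & k <= j] by rewrite ik leqnn.
have -> : WVer ikj = ws_th (WSq ikkj) by apply: w_ver_ext.
have := congr1 (tgt (hor1 D)) (@span_eq (WSq ikkj) _ _); rewrite !sqF; apply.
  by apply: aug_ver_eq => //; apply: string_uniq_ob'.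
exact: string_uniq_hor.
Qed.

Lemma string_uniq : F = G.
Proof.
apply/aug_dfunctor_ext/dfunctor_ext => x.
- exact: string_uniq_ob'.
- exact: string_uniq_hor.
- exact: string_uniq_ver.
by apply: span_eq; [apply: string_uniq_ver|apply: string_uniq_hor].
Qed.

End StringUniq.

(** In positive dimension the first step already determines the object [00] as its source. *)
Lemma string_uniq_pos (D : aug_dcat) (st : stable D) n (F G : aug_dfunctor (W n.+1) D) :
  (forall l, l < n.+1 -> df_hor F (hstep n.+1 l) = df_hor G (hstep n.+1 l)) -> F = G.
Proof.
move=> FGh; apply: (string_uniq st _ FGh); rewrite -(hstep_src n.+1 0).
have := congr1 (src (hor0 D)) (FGh 0 isT).
by rewrite (fun_src (df_hor0 F)) (fun_src (df_hor0 G)).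
Qed.

(** * The Waldhausen construction of a stable double category *)

Section WFace.
Variables (n c : nat).
Hypothesis cn : c <= n.+1.

Lemma w_hor_face (f : w_hor n.+1) :
  wh_i f <> c :> nat -> wh_j f <> c :> nat -> wh_k f <> c :> nat ->
  exists g, df_hor (W_map (coface n c)) g = f.
Proof.
case: f => i j k ijk /= /(coface_preim cn)[i' ei] /(coface_preim cn)[j' ej] /(coface_preim cn)[k' ek].
have ijk' : i' <= j' <= k' by move: ijk; rewrite -ei -ej -ek /= !leq_bump2.
by exists (WHor ijk'); apply: w_hor_ext.
Qed.

Lemma w_ver_face (v : w_ver n.+1) :
  wv_i v <> c :> nat -> wv_k v <> c :> nat -> wv_j v <> c :> nat ->
  exists u, df_ver (W_map (coface n c)) u = v.
Proof.
case: v => i j k ijk /= /(coface_preim cn)[i' ei] /(coface_preim cn)[j' ej] /(coface_preim cn)[k' ek].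
have ijk' : i' <= j' <= k' by move: ijk; rewrite -ei -ej -ek /= !leq_bump2.
by exists (WVer ijk'); apply: w_ver_ext.
Qed.
End WFace.

(** Face [i] undoes degeneracy [i], which gives injectivity, and [p] is recovered as a vertex of
    [y]. What remains of the pullback condition is that [y] is degenerate. *)
Lemma unital_of_degenerate (X : sset) :
  (forall n (i : 'I_n.+1) (y : X n.+1) (p : X 0), act (edge i) y = degen 0 p ->
     y = degen i (face i.+1 y)) ->
  unital X.
Proof.
move=> deg m i _; have i_m := ltn_ord i; split.
- move=> x _ /=; rewrite /degen -!act_comp; congr (act _ _); apply: mono_ext => j /=.
  by have := ltn_ord j; rewrite /unbump; lia.
- move=> x y _ _ [e _]; have := congr1 (face i) e; rewrite /face /degen -!act_comp.
  have -> : mono_comp (codegen m i) (coface m i) = mono_id m.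
    apply: mono_ext => k /=; have := ltn_ord k; rewrite /unbump /bump; lia.
  by rewrite !act_id.
move=> [y p] /= e; exists (face i.+1 y) => //; congr pair; first exact/esym/deg/e.
transitivity (act (vertex ord0) (act (edge i) y)).
  rewrite /face -!act_comp; congr (act _ _); apply: mono_ext => k /=.
  by rewrite /bump; lia.
rewrite e /degen -act_comp -[RHS]act_id; congr (act _ _); apply: mono_ext => k /=.
by have := ltn_ord k; lia.
Qed.

Section SOfStable.
Variables (D : aug_dcat) (st : stable D).

Local Notation H0 := (hor0 D).
Local Notation V0 := (ver0 D).
Local Notation H1 := (hor1 D).
Local Notation V1 := (ver1 D).
Local Notation "F ** p" := (aug_dfunctor_comp F (W_map p)) (at level 40).

Lemma face_hor_eq n c (F G : aug_dfunctor (W n.+1) D) (f : w_hor n.+1) :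
  c <= n.+1 -> F ** coface n c = G ** coface n c ->
  wh_i f <> c :> nat -> wh_j f <> c :> nat -> wh_k f <> c :> nat ->
  df_hor F f = df_hor G f.
Proof.
move=> cn e fi fj fk; have [g <-] := w_hor_face cn fi fj fk.
exact: (congr1 (fun E : aug_dfunctor (W n) D => df_hor E g) e).
Qed.

Lemma face_ver_eq n c (F G : aug_dfunctor (W n.+1) D) (f : w_ver n.+1) :
  c <= n.+1 -> F ** coface n c = G ** coface n c ->
  wv_i f <> c :> nat -> wv_k f <> c :> nat -> wv_j f <> c :> nat ->
  df_ver F f = df_ver G f.
Proof.
move=> cn e fi fj fk; have [g <-] := w_ver_face cn fi fj fk.
exact: (congr1 (fun E : aug_dfunctor (W n) D => df_ver E g) e).
Qed.

Let sqF n (E : aug_dfunctor (W n) D) := (fun_src (df_hor1 E), fun_tgt (df_hor1 E),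
  fun_src (df_ver1 E), fun_tgt (df_ver1 E)).

Section Ear.
Variables (n : nat) (i : 'I_n.+1).

Let a : 'I_n.+3 := ear i (@Ordinal 3 0 isT).
Let b : 'I_n.+3 := ear i (@Ordinal 3 1 isT).
Let c : 'I_n.+3 := ear i (@Ordinal 3 2 isT).

Lemma ear_sq1_le : [&& @ord0 n.+2 <= a, a <= a & a <= b].
Proof. by rewrite /= leqnn; lia. Qed.
Lemma ear_sq2_le : [&& @ord0 n.+2 <= a, a <= b & b <= c].
Proof. by rewrite /=; lia. Qed.

(* The two squares joining the top row to the horizontal morphisms
   ii >-> i(i+1) >-> i(i+2) of the ear. *)
Definition ear_sq1 : w_sq n.+2 := WSq ear_sq1_le.
Definition ear_sq2 : w_sq n.+2 := WSq ear_sq2_le.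

Lemma ear_top1 : ws_sv ear_sq1 = hstep n.+2 i.
Proof. by apply: w_hor_ext; apply: val_inj => //=; have := ltn_ord i; lia. Qed.
Lemma ear_top2 : ws_sv ear_sq2 = hstep n.+2 i.+1.
Proof. by apply: w_hor_ext; apply: val_inj => //=; have := ltn_ord i; lia. Qed.
Lemma ear_bot1 : ws_tv ear_sq1 = df_hor (W_map (ear i)) (hstep 2 0).
Proof. by apply: w_hor_ext; apply: val_inj. Qed.
Lemma ear_bot2 : ws_tv ear_sq2 = df_hor (W_map (ear i)) (hstep 2 1).
Proof. by apply: w_hor_ext; apply: val_inj. Qed.
Lemma ear_mid : ws_th ear_sq1 = ws_sh ear_sq2.
Proof. exact: w_ver_ext. Qed.

(** The right side [0c ->> ac] of the second square avoids the tip [b], and its bottom lies in the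
    ear, so cospan uniqueness fixes this square and then the first one. Their tops are the two steps
    of the top row that meet the tip. *)
Lemma S_ear_inj (F G : aug_dfunctor (W n.+2) D) :
  F ** coface n.+1 i.+1 = G ** coface n.+1 i.+1 -> F ** ear i = G ** ear i -> F = G.
Proof.
move=> eF eE; have i1 : i.+1 <= n.+2 by have := ltn_ord i; lia.
have e2 : df_sq F ear_sq2 = df_sq G ear_sq2.
  apply: (cospan_uniq st); rewrite !sqF.
    by apply: (face_ver_eq i1 eF) => /=; lia.
  rewrite [tgt _ _]ear_bot2.
  exact: (congr1 (fun E : aug_dfunctor (W 2) D => df_hor E (hstep 2 1)) eE).
have e1 : df_sq F ear_sq1 = df_sq G ear_sq1.
  apply: (cospan_uniq st); rewrite !sqF.
    by have := congr1 (src H1) e2; rewrite !sqF [src _ _](esym ear_mid).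
  rewrite [tgt _ _]ear_bot1.
  exact: (congr1 (fun E : aug_dfunctor (W 2) D => df_hor E (hstep 2 0)) eE).
apply: (string_uniq_pos st) => l ln.
have [->|li] := eqVneq l i.
  by have := congr1 (src V1) e1; rewrite !sqF [src _ _]ear_top1.
have [->|li1] := eqVneq l i.+1.
  by have := congr1 (src V1) e2; rewrite !sqF [src _ _]ear_top2.
by apply: (face_hor_eq i1 eF) => /=; lia.
Qed.

(** The step [0i >-> 0(i+1)] of [y] has to be split in two. The square [s'] below it has bottom
    [ii >-> i(i+1)], which [z] factors; filling two cospans from right to left lifts this
    factorization to the top. *)
Lemma S_ear_fill (y : aug_dfunctor (W n.+1) D) (z : aug_dfunctor (W 2) D) :
  y ** edge i = z ** coface 1 1 ->
  exists x : aug_dfunctor (W n.+2) D, x ** coface n.+1 i.+1 = y /\ x ** ear i = z.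
Proof.
move=> e; have i1 : i.+1 <= n.+2 by have := ltn_ord i; lia.
pose a' : 'I_n.+2 := edge i ord0; pose c' : 'I_n.+2 := edge i ord_max.
have s'_le : [&& @ord0 n.+1 <= a', a' <= a' & a' <= c'] by rewrite /= leqnn; lia.
pose s' : w_sq n.+1 := WSq s'_le.
have [g hg] : exists g, composes (hor0 (W 2)) (hstep 2 0) (hstep 2 1) g.
  by apply: composes_ex; apply: w_ob_ext; apply: val_inj.
have bot' : df_hor y (ws_tv s') = df_hor z g.
  have -> : ws_tv s' = df_hor (W_map (edge i)) (hstep 1 0).
    by apply: w_hor_ext; apply: val_inj.
  have -> : g = df_hor (W_map (coface 1 1)) (hstep 1 0).
    by case: hg => ? <-; apply: w_hor_ext; apply: val_inj.
  exact: (congr1 (fun E : aug_dfunctor (W 1) D => df_hor E (hstep 1 0)) e).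
have hzg := functor_composes (df_hor0 z) hg.
have [|s2 [s2v s2h]] := @cospan_fill _ st (df_ver y (ws_th s')) (df_hor z (hstep 2 1)).
  by rewrite -(composes_tgt hzg) -bot' -!sqF sq_br.
have [|s1 [s1v s1h]] := @cospan_fill _ st (src H1 s2) (df_hor z (hstep 2 0)).
  by rewrite sq_bl s2h (composes_eq hzg).
(* The pasting of [s1] and [s2] has the right side and bottom of the image of [s'], hence equals it,
   so the tops of [s1] and [s2] compose to the step of [y]. *)
have s12 : composes H1 s1 s2 (df_sq y s').
  have [s hs] := composes_ex s1v; suff <- : s = df_sq y s' by [].
  apply: (cospan_uniq st); first by rewrite (composes_tgt hs) s2v sqF.
  have := functor_composes (tgt_ver_functor D) hs; rewrite s1h s2h.
  by move/(composes_uniq hzg) => <-; rewrite sqF bot'.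
have left1 : src H1 s1 = df_ver y (ws_sh s') by rewrite -(composes_src s12) sqF.
have top12 : composes H0 (src V1 s1) (src V1 s2) (df_hor y (ws_sv s')).
  by have := functor_composes (src_ver_functor D) s12; rewrite sqF.
have ysrc l : src H0 (df_hor y (hstep n.+1 l)) = df_ob y (obstep n.+1 l).
  by rewrite (fun_src (df_hor0 y)) -hstep_src.
have ytgt l : tgt H0 (df_hor y (hstep n.+1 l)) = df_ob y (obstep n.+1 l.+1).
  by rewrite (fun_tgt (df_hor0 y)) -hstep_tgt.
have tops' : ws_sv s' = hstep n.+1 i.
  by apply: w_hor_ext; apply: val_inj => //=; have := ltn_ord i; lia.
rewrite tops' in top12.
(* The new top row: the two tops replace step [i], and the later steps of [y] move up by one
   index. *)
pose h l := if l < i then df_hor y (hstep n.+1 l) else if l == i then src V1 s1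
  else if l == i.+1 then src V1 s2 else df_hor y (hstep n.+1 l.-1).
pose o l := if l <= i then df_ob y (obstep n.+1 l) else if l == i.+1 then tgt H0 (src V1 s1)
  else df_ob y (obstep n.+1 l.-1).
have hi : h i = src V1 s1 by rewrite /h ltnn eqxx.
have hi1 : h i.+1 = src V1 s2 by rewrite /h ltnNge leqnSn /= gtn_eqF // eqxx.
have [|||x [x0 xh]] := @string_exists D st n.+2 o h.
- move=> l; rewrite /h /o; case: ltngtP => [li|il|->].
  + by rewrite ysrc.
  + have [_|li1] := eqVneq l i.+1; first by rewrite (composes_eq top12).
    by rewrite ysrc.
  + by rewrite -(composes_src top12) ysrc.
- move=> l; rewrite /h /o; case: ltngtP => [li|il|->].
  + by rewrite ytgt.
  + rewrite eqSS (gtn_eqF il); have [->|li1] := eqVneq l i.+1.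
      by rewrite -(composes_tgt top12) ytgt.
    by rewrite ytgt prednK // (leq_ltn_trans _ il).
  + by rewrite eqxx.
- have a0 : aug (a := W n.+1) (obstep n.+1 0) by apply: val_inj.
  exact: (adf_aug y a0).
exists x.
have xy : x ** coface n.+1 i.+1 = y.
  apply: (string_uniq_pos st) => l ln /=.
  have [li|li|li] := ltngtP l i.
  + rewrite (_ : WHor _ = hstep n.+2 l); last first.
      by apply: w_hor_ext; apply: val_inj => //=; rewrite /bump; lia.
    by rewrite xh ?/h ?li //; lia.
  + rewrite (_ : WHor _ = hstep n.+2 l.+1); last first.
      by apply: w_hor_ext; apply: val_inj => //=; rewrite /bump; lia.
    rewrite xh ?/h ?eqSS ?(gtn_eqF li) //.
    by rewrite ltnNge (leq_trans (ltnW li)) // gtn_eqF // ltnS ltnW.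
  have [f hf] : exists f, composes (hor0 (W n.+2)) (hstep n.+2 i) (hstep n.+2 i.+1) f.
    by apply: composes_ex; rewrite /= hstep_src hstep_tgt.
  rewrite (_ : WHor _ = f); last first.
    by case: hf => ? <-; apply: w_hor_ext; apply: val_inj => //=; rewrite /bump; lia.
  have := functor_composes (df_hor0 x) hf; rewrite li !xh //; last by lia.
  by rewrite hi hi1 => /(composes_uniq top12) <-.
split=> //.
(* The squares of [x] over the ear have the left sides and tops of [s1] and [s2], so they are these
   squares, and their bottoms are the two steps of [z]. *)
have xs1 : df_sq x ear_sq1 = s1.
  apply: (span_uniq st); rewrite sqF.
    rewrite left1 -xy /=; congr (df_ver x _).
    by apply: w_ver_ext; apply: val_inj => //=; rewrite /bump; lia.
  by rewrite [src _ _]ear_top1 xh ?hi //; lia.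
have xs2 : df_sq x ear_sq2 = s2.
  apply: (span_uniq st); rewrite sqF.
    by rewrite -s1v -xs1 sqF; congr (df_ver x _); apply: esym ear_mid.
  by rewrite [src _ _]ear_top2 xh ?hi1 // ltnS ltn_ord.
apply: (string_uniq_pos st) => -[|[|//]] _.
  by rewrite -s1h -xs1 sqF; congr (df_hor x _); rewrite [RHS]ear_bot1.
by rewrite -s2h -xs2 sqF; congr (df_hor x _); rewrite [RHS]ear_bot2.
Qed.

End Ear.

Lemma S_two_segal : two_segal (S_obj D).
Proof.
apply: two_segal_of_ears => n i; first exact: S_ear_inj.
exact: S_ear_fill.
Qed.

(* The square (0, i, i, i+1) and the identity square on its right side fill the
   same cospan. *)
Lemma degenerate_step n (y : aug_dfunctor (W n.+1) D) (i : 'I_n.+1) (p : aug_dfunctor (W 0) D) :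
  y ** edge i = p ** codegen 0 0 ->
  df_hor y (hstep n.+1 i) = idm H0 (df_ob y (obstep n.+1 i.+1)).
Proof.
move=> e; pose a' : 'I_n.+2 := edge i ord0; pose c' : 'I_n.+2 := edge i ord_max.
have s_le : [&& @ord0 n.+1 <= a', a' <= a' & a' <= c'] by rewrite /= leqnn; lia.
pose s : w_sq n.+1 := WSq s_le.
have -> : hstep n.+1 i = ws_sv s.
  by apply: w_hor_ext; apply: val_inj => //=; have := ltn_ord i; lia.
have -> : obstep n.+1 i.+1 = wv_src (ws_th s).
  by apply: w_ob_ext; apply: val_inj => //=; have := ltn_ord i; lia.
have bot : df_hor y (ws_tv s) = idm H0 (df_ob p (obstep 0 0)).
  rewrite -(fun_idm (df_hor0 p)).
  transitivity (df_hor y (df_hor (W_map (edge i)) (hstep 1 0))).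
    by congr (df_hor y _); apply: w_hor_ext; apply: val_inj.
  transitivity (df_hor p (df_hor (W_map (codegen 0 0)) (hstep 1 0))).
    exact: (congr1 (fun E : aug_dfunctor (W 1) D => df_hor E (hstep 1 0)) e).
  by congr (df_hor p _); apply: w_hor_ext; apply: val_inj.
suff es : df_sq y s = idm H1 (df_ver y (ws_th s)).
  have := congr1 (src V1) es; rewrite sqF (fun_idm (src_ver_functor D)).
  by rewrite (fun_src (df_ver0 y)).
apply: (cospan_uniq st); first by rewrite sqF tgt_idm.
rewrite (fun_idm (tgt_ver_functor D)) sqF bot.
by have := sq_br (df_sq y s); rewrite !sqF bot tgt_idm => ->.
Qed.

(** The composite of [codegen n i] and [coface n i.+1] moves [i.+1] to [i] and fixes the other
    vertices. The top row of [y] does not see the difference, because its step [i] is an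
    identity. *)
Lemma S_degenerate n (i : 'I_n.+1) (y : aug_dfunctor (W n.+1) D) (p : aug_dfunctor (W 0) D) :
  y ** edge i = p ** codegen 0 0 -> y = y ** coface n i.+1 ** codegen n i.
Proof.
move=> /degenerate_step yi; have i_n := ltn_ord i.
have yob : df_ob y (obstep n.+1 i) = df_ob y (obstep n.+1 i.+1).
  have := congr1 (src H0) yi.
  by rewrite src_idm (fun_src (df_hor0 y)) -[src _ (hstep _ _)]/(wh_src _) hstep_src.
apply: (string_uniq_pos st) => l ln /=.
have [li|il|li] := ltngtP l i.
- congr (df_hor y _); apply: w_hor_ext; apply: val_inj => //=; rewrite /bump /unbump; lia.
- have [l1|l1] := eqVneq l i.+1; last first.
    congr (df_hor y _); apply: w_hor_ext; apply: val_inj => //=; rewrite /bump /unbump; lia.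
  (* On the right-hand side, step [i.+1] is the composite of the steps [i] and [i.+1] of [y], the
     first of which is an identity. *)
  have [f hf] : exists f, composes (hor0 (W n.+1)) (hstep n.+1 i) (hstep n.+1 l) f.
    by apply: composes_ex; rewrite /= hstep_src hstep_tgt l1.
  rewrite (_ : WHor _ = f); last first.
    by case: hf => ? <-; apply: w_hor_ext; apply: val_inj => //=; rewrite /bump /unbump; lia.
  have := functor_composes (df_hor0 y) hf; rewrite yi => c.
  apply: composes_uniq c; apply: composes_idl.
  by rewrite (fun_src (df_hor0 y)) -[src _ (hstep _ _)]/(wh_src _) hstep_src l1.
rewrite li yi -yob -(fun_idm (df_hor0 y)); congr (df_hor y _).
by apply: w_hor_ext; apply: val_inj => //=; rewrite /bump /unbump; lia.
Qed.

Lemma S_unital : unital (S_obj D).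
Proof. by apply: unital_of_degenerate => n i y p; apply: S_degenerate. Qed.

End SOfStable.

Lemma S_reduced (D : pt_dcat) : stable D -> reduced (S_obj (aug_of_pt D)).
Proof.
move=> st; pose D' := aug_of_pt D.
have [||//|F _] := @string_exists D' st 0 (fun _ => pt D) (fun _ => idm (hor0 D') (pt D)).
- by move=> l; rewrite src_idm.
- by move=> l; rewrite tgt_idm.
exists F => G; apply: (string_uniq (D := D') st) => //.
have a0 : aug (a := W 0) (obstep 0 0) by apply: val_inj.
by rewrite (adf_aug F a0) (adf_aug G a0).
Qed.

(** * The counit *)

Ltac w_eq := solve
  [ by [] | by apply: w_ob_ext; apply: val_inj | by apply: w_hor_ext; apply: val_inj
  | by apply: w_ver_ext; apply: val_inj | by apply: w_sq_ext; apply: val_inj ].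

Definition gen_ob : w_ob 1 := @WOb 1 (trunc 1 0) (trunc 1 1) isT.
Definition gen_hor : w_hor 2 := @WHor 2 (trunc 2 0) (trunc 2 1) (trunc 2 2) isT.
Definition gen_ver : w_ver 2 := @WVer 2 (trunc 2 0) (trunc 2 1) (trunc 2 2) isT.
Definition gen_sq : w_sq 3 := @WSq 3 (trunc 3 0) (trunc 3 1) (trunc 3 2) (trunc 3 3) isT.

(** * Cells of [D] as diagrams of dimension at most 3 *)

Section Generators.
Variables (D : aug_dcat) (st : stable D).

Local Notation H0 := (hor0 D).
Local Notation V0 := (ver0 D).
Local Notation H1 := (hor1 D).
Local Notation V1 := (ver1 D).

Let sqF n (E : aug_dfunctor (W n) D) := (fun_src (df_hor1 E), fun_tgt (df_hor1 E),
  fun_src (df_ver1 E), fun_tgt (df_ver1 E)).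

Lemma short_string n h0 h1 h2 : n <= 3 -> tgt H0 h0 = src H0 h1 -> tgt H0 h1 = src H0 h2 ->
  aug (src H0 h0) ->
  exists F : aug_dfunctor (W n) D,
    forall l, l < n -> df_hor F (hstep n l) = nth h0 [:: h0; h1; h2] l.
Proof.
move=> n3 e01 e12 a0; set d := tgt H0 h2.
(* Strings are infinite, so after the third morphism this one is continued by identities of [d]. *)
have [|||F [_ Fh]] := @string_exists D st n (nth d [:: src H0 h0; src H0 h1; src H0 h2])
    (nth (idm H0 d) [:: h0; h1; h2]).
- by case=> [|[|[|l]]] //=; rewrite !nth_nil src_idm.
- by case=> [|[|[|l]]] //=; rewrite !nth_nil tgt_idm.
- by [].
exists F => l ln; rewrite Fh //; apply: set_nth_default; exact: leq_trans ln n3.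
Qed.

Lemma aug_step_src n (F : aug_dfunctor (W n) D) (f : w_hor n) :
  wh_i f = wh_j f -> aug (src H0 (df_hor F f)).
Proof. by move=> e; rewrite (fun_src (df_hor0 F)); apply: adf_aug. Qed.

Lemma aug_step_eq n (F G : aug_dfunctor (W n) D) (f : w_hor n) : wh_i f = wh_j f ->
  df_ob F (wh_tgt f) = df_ob G (wh_tgt f) -> df_hor F f = df_hor G f.
Proof.
move=> e h; apply: aug_hor_inj; try exact: aug_step_src.
by rewrite !(fun_tgt (df_hor0 _)).
Qed.

(** The first step starts in the augmentation, so it is determined by its target, the source of the
    second step [gen_hor]. *)
Lemma gen_hor_inj : injective (fun F : aug_dfunctor (W 2) D => df_hor F gen_hor).
Proof.
move=> F G e; have E : hstep 2 1 = gen_hor by w_eq.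
apply: (string_uniq_pos st) => -[|[|//]] _; last by rewrite E.
apply: aug_step_eq; first exact: val_inj.
have := congr1 (src H0) e; rewrite !(fun_src (df_hor0 _)).
by have -> : wh_tgt (hstep 2 0) = wh_src gen_hor by w_eq.
Qed.

Lemma gen_hor_surj f : exists F : aug_dfunctor (W 2) D, df_hor F gen_hor = f.
Proof.
have [h0 [[h0a h0t] _]] := aug_hor (src H0 f).
have [|F Fh] := @short_string 2 h0 f (idm H0 (tgt H0 f)) isT h0t _ h0a.
  by rewrite src_idm.
by exists F; rewrite -[RHS](Fh 1 isT); congr (df_hor F _); w_eq.
Qed.

Lemma gen_ob_inj : injective (fun F : aug_dfunctor (W 1) D => df_ob F gen_ob).
Proof.
move=> F G e; apply: (string_uniq_pos st) => -[|//] _.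
apply: aug_step_eq; first exact: val_inj.
by have -> : wh_tgt (hstep 1 0) = gen_ob by w_eq.
Qed.

Lemma gen_ob_surj d : exists F : aug_dfunctor (W 1) D, df_ob F gen_ob = d.
Proof.
have [h0 [[h0a h0t] _]] := aug_hor d.
have [||F Fh] := @short_string 1 h0 (idm H0 d) (idm H0 d) isT _ _ h0a.
- by rewrite src_idm.
- by rewrite src_idm tgt_idm.
exists F; transitivity (tgt H0 (df_hor F (hstep 1 0))); last by rewrite (Fh 0 isT).
by rewrite (fun_tgt (df_hor0 _)); congr (df_ob F _); w_eq.
Qed.

(** This square has top [gen_hor] and right side [gen_ver], while its lower left corner [11] is
    augmented. It translates between horizontal and vertical morphisms. *)
Definition tri_sq : w_sq 2 := @WSq 2 (trunc 2 0) (trunc 2 1) (trunc 2 1) (trunc 2 2) isT.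

Lemma gen_ver_inj : injective (fun F : aug_dfunctor (W 2) D => df_ver F gen_ver).
Proof.
move=> F G e; have th : ws_th tri_sq = gen_ver by w_eq.
have es : df_sq F tri_sq = df_sq G tri_sq.
  apply: (cospan_uniq st); rewrite !sqF; first by rewrite [tgt _ _]th.
  apply: aug_step_eq => //; have := congr1 (tgt V0) e.
  rewrite !(fun_tgt (df_ver0 _)).
  by have -> : wh_tgt (tgt (ver1 (W 2)) tri_sq) = wv_tgt gen_ver by w_eq.
apply: gen_hor_inj; have := congr1 (src V1) es; rewrite !sqF.
by have -> : src (ver1 (W 2)) tri_sq = gen_hor by w_eq.
Qed.

(** Complete [v] to a cospan by the horizontal morphism from the augmentation to its target; the top
    of the filler, viewed as a 2-simplex, has [v] as its vertical part. *)
Lemma gen_ver_surj v : exists F : aug_dfunctor (W 2) D, df_ver F gen_ver = v.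
Proof.
have [b [[ba bt] _]] := aug_hor (tgt V0 v).
have [s [sv sb]] := cospan_fill st (esym bt).
have [F Fh] := gen_hor_surj (src V1 s); exists F.
have th : ws_th tri_sq = gen_ver by w_eq.
have tv : ws_sv tri_sq = gen_hor by w_eq.
suff es : df_sq F tri_sq = s.
  by have := congr1 (tgt H1) es; rewrite sqF sv => <-; rewrite [tgt _ _]th.
apply: (span_uniq st); rewrite sqF; last by rewrite [src _ _]tv.
rewrite [LHS]averE; last by rewrite (fun_tgt (df_ver0 F)); apply: adf_aug.
rewrite [RHS]averE; last by rewrite sq_bl sb.
congr aver; rewrite sq_tl -Fh -tv (fun_src (df_ver0 F)) (fun_src (df_hor0 F)).
by congr (df_ob F _); w_eq.
Qed.

Lemma gen_sq_inj : injective (fun F : aug_dfunctor (W 3) D => df_sq F gen_sq).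
Proof.
move=> F G e.
have e3 : aug_dfunctor_comp F (W_map (coface 2 3)) = aug_dfunctor_comp G (W_map (coface 2 3)).
  apply: gen_ver_inj; have := congr1 (src H1) e; rewrite !sqF /=.
  by have -> : ws_sh gen_sq = WVer (wm_ver_le (coface 2 3) gen_ver) by w_eq.
apply: (string_uniq_pos st) => l l3; have [l2|l2] := ltnP l 2.
  by apply: (face_hor_eq _ e3) => //=; lia.
have -> : hstep 3 l = ws_sv gen_sq by apply: w_hor_ext; apply: val_inj => //=; lia.
by have := congr1 (src V1) e; rewrite !sqF.
Qed.

(** The left side of [s] comes from a 2-simplex [G]; its string is extended by the top of [s]. *)
Lemma gen_sq_surj s : exists F : aug_dfunctor (W 3) D, df_sq F gen_sq = s.
Proof.
have [G Gv] := gen_ver_surj (src H1 s).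
have e01 : tgt H0 (df_hor G (hstep 2 0)) = src H0 (df_hor G (hstep 2 1)).
  by rewrite (fun_tgt (df_hor0 G)) (fun_src (df_hor0 G)) /= hstep_src hstep_tgt.
have e12 : tgt H0 (df_hor G (hstep 2 1)) = src H0 (src V1 s).
  rewrite -sq_tl -Gv (fun_tgt (df_hor0 G)) (fun_src (df_ver0 G)).
  by congr (df_ob G _); w_eq.
have [|F Fh] := @short_string 3 _ _ _ isT e01 e12; first by apply: aug_step_src; apply: val_inj.
exists F.
have F3 : aug_dfunctor_comp F (W_map (coface 2 3)) = G.
  apply: (string_uniq_pos st) => -[|[|//]] _ /=.
    by rewrite -[RHS](Fh 0 isT); congr (df_hor F _); w_eq.
  by rewrite -[RHS](Fh 1 isT); congr (df_hor F _); w_eq.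
apply: (span_uniq st); rewrite sqF.
  by rewrite -Gv -F3 /=; congr (df_ver F _); w_eq.
by rewrite -[RHS](Fh 2 isT); congr (df_hor F _); w_eq.
Qed.

End Generators.

Lemma bijective_of_surj T U (f : T -> U) :
  injective f -> (forall y, exists x, f x = y) -> bijective f.
Proof.
by move=> fi /choice[g fg]; exists g => // x; apply: fi; rewrite fg.
Qed.

Section Counit.
Variables (D : aug_dcat) (XS : two_segal (S_obj D)) (XU : unital (S_obj D)).

Local Notation SD n := (aug_dfunctor (W n) D).

Definition counit_dmap : dfunctor (P_obj XS XU) D.
Proof.
refine (@DFunctor (P_obj XS XU) D
  (fun F : SD 1 => df_ob F gen_ob) (fun F : SD 2 => df_hor F gen_hor)
  (fun F : SD 2 => df_ver F gen_ver) (fun F : SD 3 => df_sq F gen_sq) _ _ _ _);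
  apply: is_functor_of_composes.
- by move=> F; rewrite (fun_src (df_hor0 _)); congr (df_ob F _); w_eq.
- by move=> F; rewrite (fun_tgt (df_hor0 _)); congr (df_ob F _); w_eq.
- by move=> F; rewrite -(fun_idm (df_hor0 _)); congr (df_hor F _); w_eq.
(* Composites in the path construction are faces of a filler [z], itself a double functor: it
   carries the matching composite in [W 3] (in [W 4] for squares) to the one in [D]. *)
- move=> F G _ [e <-]; change (mcomp e) with (face 2 (inv2 (fill02 XS e))); have [] := inv2P (fill02 XS e).
  move: (inv2 _) => z <- <-; apply: (functor_composes (df_hor0 z)).
  by unshelve eexists; w_eq.
- by move=> F; rewrite (fun_src (df_ver0 _)); congr (df_ob F _); w_eq.
- by move=> F; rewrite (fun_tgt (df_ver0 _)); congr (df_ob F _); w_eq.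
- by move=> F; rewrite -(fun_idm (df_ver0 _)); congr (df_ver F _); w_eq.
- move=> F G _ [e <-]; change (mcomp e) with (face 1 (inv2 (fill13 XS e))); have [] := inv2P (fill13 XS e).
  move: (inv2 _) => z <- <-; apply: (functor_composes (df_ver0 z)).
  by unshelve eexists; w_eq.
- by move=> F; rewrite (fun_src (df_hor1 _)); congr (df_ver F _); w_eq.
- by move=> F; rewrite (fun_tgt (df_hor1 _)); congr (df_ver F _); w_eq.
- by move=> F; rewrite -(fun_idm (df_hor1 _)); congr (df_sq F _); w_eq.
- move=> F G _ [e <-]; change (mcomp e) with (face 3 (inv2 (fillh XS e))); have [] := inv2P (fillh XS e).
  move: (inv2 _) => z <- <-; apply: (functor_composes (df_hor1 z)).
  by unshelve eexists; w_eq.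
- by move=> F; rewrite (fun_src (df_ver1 _)); congr (df_hor F _); w_eq.
- by move=> F; rewrite (fun_tgt (df_ver1 _)); congr (df_hor F _); w_eq.
- by move=> F; rewrite -(fun_idm (df_ver1 _)); congr (df_sq F _); w_eq.
- move=> F G _ [e <-]; change (mcomp e) with (face 1 (inv2 (fillv XS e))); have [] := inv2P (fillv XS e).
  move: (inv2 _) => z <- <-; apply: (functor_composes (df_ver1 z)).
  by unshelve eexists; w_eq.
Defined.

Lemma counit_aug a : aug (a := P_obj XS XU) a -> aug (df_ob counit_dmap a).
Proof.
case=> p _ <-; have pa : aug (a := W 0) (df_ob (W_map (codegen 0 0)) gen_ob) by apply: val_inj.
exact: (adf_aug (p : SD 0) pa).
Qed.

Definition counit : aug_dfunctor (P_obj XS XU) D := AugDFunctor counit_aug.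

(** For the inverse of the counit to be augmented, objects of the augmentation must have preimages
    in the augmentation. *)
Lemma counit_aug_surj (st : stable D) a :
  aug a -> exists2 b, aug (a := P_obj XS XU) b & df_ob counit b = a.
Proof.
move=> aa; have [||//|p [p0 _]] := @string_exists D st 0 (fun _ => a) (fun _ => idm (hor0 D) a).
- by move=> l; rewrite src_idm.
- by move=> l; rewrite tgt_idm.
exists (degen (X := S_obj D) 0 p); first by exists p.
by rewrite -p0 /=; congr (df_ob p _); w_eq.
Qed.

End Counit.

(** * The unit *)

Lemma is_functor_inv O M O' M' (C : cat_on O M) (C' : cat_on O' M') fo fm go gm :
  is_functor C C' fo fm -> cancel fo go -> cancel go fo -> cancel fm gm -> cancel gm fm ->
  is_functor C' C go gm.
Proof.
move=> F foK goK fmK gmK; apply: is_functor_of_composes => [f|f|a|f g h [e <-]].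
- by apply: (can_inj foK); rewrite goK -(fun_src F) gmK.
- by apply: (can_inj foK); rewrite goK -(fun_tgt F) gmK.
- by apply: (can_inj fmK); rewrite gmK (fun_idm F) goK.
have e1 : tgt C (gm f) = src C (gm g).
  by apply: (can_inj foK); rewrite -(fun_tgt F) -(fun_src F) !gmK.
exists e1; apply: (can_inj fmK); rewrite gmK.
apply/esym/composes_mcompE; rewrite -[X in composes _ X](gmK f) -[X in composes _ _ X](gmK g).
exact/(functor_composes F)/composes_mcomp.
Qed.

Lemma dfunctor_inv D D' (F : dfunctor D D') :
  bijective (df_ob F) -> bijective (df_hor F) -> bijective (df_ver F) -> bijective (df_sq F) ->
  exists G : dfunctor D' D,
    dfunctor_comp G F = dfunctor_id D /\ dfunctor_comp F G = dfunctor_id D'.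
Proof.
case=> go oK oK' [gh hK hK'] [gv vK vK'] [gs sK sK'].
exists (DFunctor (is_functor_inv (df_hor0 F) oK oK' hK hK')
  (is_functor_inv (df_ver0 F) oK oK' vK vK') (is_functor_inv (df_hor1 F) vK vK' sK sK')
  (is_functor_inv (df_ver1 F) hK hK' sK sK')).
by split; apply: dfunctor_ext.
Qed.

Lemma smap_inv X Y (f : smap X Y) : (forall n, bijective (f n)) ->
  exists g : smap Y X, smap_comp g f = smap_id X /\ smap_comp f g = smap_id Y.
Proof.
move=> bf; have [g gP] : exists g : forall n, Y n -> X n,
    forall n, cancel (f n) (g n) /\ cancel (g n) (f n).
  have h n : {g : Y n -> X n | cancel (f n) g /\ cancel g (f n)}.
    by apply: cid; case: (bf n) => g; exists g.
  by exists (fun n => sval (h n)) => n; apply: (svalP (h n)).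
have gn m n (p : mono m n) y : g m (act p y) = act p (g n y).
  by apply: (can_inj (gP m).1); rewrite smap_nat !(gP _).2.
by exists (SMap gn); split; apply: smap_ext => n x /=; rewrite (gP n).1 || rewrite (gP n).2.
Qed.

Section CounitBij.
Variables (D : aug_dcat) (st : stable D) (XS : two_segal (S_obj D)) (XU : unital (S_obj D)).

Lemma counit_inv : exists G : dfunctor D (P_obj XS XU),
  dfunctor_comp G (counit XS XU) = dfunctor_id _ /\
  dfunctor_comp (counit XS XU) G = dfunctor_id D.
Proof.
apply: dfunctor_inv; apply: bijective_of_surj.
- exact: gen_ob_inj.
- exact: gen_ob_surj.
- exact: gen_hor_inj.
- exact: gen_hor_surj.
- exact: gen_ver_inj.
- exact: gen_ver_surj.
- exact: gen_sq_inj.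
- exact: gen_sq_surj.
Qed.

End CounitBij.

Lemma nth_mono_homo m n (s : seq 'I_n.+1) : size s = m.+1 ->
  sorted (fun i j : 'I_n.+1 => (i <= j)%N) s ->
  {homo (fun k : 'I_m.+1 => nth ord0 s k) : j k / (j <= k)%N}.
Proof.
move=> sm ss j k jk.
apply: (sorted_leq_nth _ _ ord0 ss) => //; try by rewrite inE sm.
by move=> ? ? ?; apply: leq_trans.
Qed.

Definition nth_mono m n (s : seq 'I_n.+1)
  (ss : sorted (fun i j : 'I_n.+1 => (i <= j)%N) s) (sm : size s = m.+1) : mono m n := Mono (nth_mono_homo sm ss).

Section WMono.
Variable n : nat.

Lemma ob_mono_sorted (a : w_ob n) : sorted (fun i j : 'I_n.+1 => (i <= j)%N) [:: wo_i a; wo_j a].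
Proof. by rewrite /= wo_le. Qed.
Lemma hor_mono_sorted (f : w_hor n) :
  sorted (fun i j : 'I_n.+1 => (i <= j)%N) [:: wh_i f; wh_j f; wh_k f].
Proof. by rewrite /= andbT wh_le. Qed.
Lemma ver_mono_sorted (v : w_ver n) :
  sorted (fun i j : 'I_n.+1 => (i <= j)%N) [:: wv_i v; wv_k v; wv_j v].
Proof. by rewrite /= andbT wv_le. Qed.
Lemma sq_mono_sorted (s : w_sq n) :
  sorted (fun i j : 'I_n.+1 => (i <= j)%N) [:: ws_i s; ws_k s; ws_j s; ws_l s].
Proof. by rewrite /= andbT ws_le. Qed.

Definition ob_mono a : mono 1 n := @nth_mono 1 n _ (ob_mono_sorted a) erefl.
Definition hor_mono f : mono 2 n := @nth_mono 2 n _ (hor_mono_sorted f) erefl.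
Definition ver_mono v : mono 2 n := @nth_mono 2 n _ (ver_mono_sorted v) erefl.
Definition sq_mono s : mono 3 n := @nth_mono 3 n _ (sq_mono_sorted s) erefl.
End WMono.

Ltac act_eq := rewrite /face /degen -?act_comp; congr (act _ _); apply: mono_ext;
  by case=> [[|[|[|[|[|?]]]]] ?].

Lemma bijective_section T U (f : T -> U) (g : U -> T) : injective g -> cancel f g -> bijective f.
Proof. by move=> gi fg; exists g => // y; apply: gi; rewrite fg. Qed.

Section Unit.
Variables (X : sset) (XS : two_segal X).

Definition unit_dfunctor n (x : X n) : dfunctor (W n) (P_dcat XS).
Proof.
refine (@DFunctor (W n) (P_dcat XS)
  (fun a : w_ob n => act (ob_mono a) x) (fun f : w_hor n => act (hor_mono f) x)
  (fun v : w_ver n => act (ver_mono v) x) (fun s : w_sq n => act (sq_mono s) x) _ _ _ _);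
  apply: is_functor_of_composes => /=.
- by move=> f; act_eq.
- by move=> f; act_eq.
- by move=> a; act_eq.
- case=> i j k f [i' k' l g] _ [e <-]; have [/= ei ek] := e; subst i' k'.
  have ss : sorted (fun i j : 'I_n.+1 => (i <= j)%N) [:: i; j; k; l].
    by case/andP: f g {e} => /= -> -> /andP[_ ->].
  unshelve eexists; first by rewrite /=; act_eq.
  (* The face of [x] on the vertices [i, j, k, l] is the filler that defines this composite; the
     other three compositions are treated alike. *)
  by rewrite /= (@ph_compE _ _ _ _ _ (act (@nth_mono 3 n _ ss erefl) x)); act_eq.
- by move=> f; act_eq.
- by move=> f; act_eq.
- by move=> a; act_eq.
- case=> i k j f [k' m j' g] _ [e <-]; have [/= ek ej] := e; subst k' j'.
  have ss : sorted (fun i j : 'I_n.+1 => (i <= j)%N) [:: i; k; m; j].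
    by case/andP: f g {e} => /= -> _ /andP[-> ->].
  unshelve eexists; first by rewrite /=; act_eq.
  by rewrite /= (@pv_compE _ _ _ _ _ (act (@nth_mono 3 n _ ss erefl) x)); act_eq.
- by move=> f; act_eq.
- by move=> f; act_eq.
- by move=> a; act_eq.
- case=> i k j l f [i' k' l' m g] _ [e <-]; have [/= ei ek el] := e; subst i' k' l'.
  have ss : sorted (fun i j : 'I_n.+1 => (i <= j)%N) [:: i; k; j; l; m].
    by case/and3P: f g {e} => /= -> -> -> /and3P[_ _ ->].
  unshelve eexists; first by rewrite /=; act_eq.
  by rewrite /= (@psh_compE _ _ _ _ _ (act (@nth_mono 4 n _ ss erefl) x)); act_eq.
- by move=> f; act_eq.
- by move=> f; act_eq.
- by move=> a; act_eq.
- case=> i k j l f [k' m j' l' g] _ [e <-]; have [/= ek ej el] := e; subst k' j' l'.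
  have ss : sorted (fun i j : 'I_n.+1 => (i <= j)%N) [:: i; k; m; j; l].
    by case/and3P: f g {e} => /= -> _ -> /and3P[-> ->].
  unshelve eexists; first by rewrite /=; act_eq.
  by rewrite /= (@psv_compE _ _ _ _ _ (act (@nth_mono 4 n _ ss erefl) x)); act_eq.
Defined.

(* The augmentation is a parameter equal to [P_aug XS], so that the pointed
   version of the path construction is covered as well. *)
Variables (A : set (Ob (P_dcat XS))) (AE : A = P_aug (XS := XS)).
Variables (Ah : forall d, exists! f : Hor (P_dcat XS),
    A (src (hor0 (P_dcat XS)) f) /\ tgt (hor0 (P_dcat XS)) f = d)
  (Av : forall d, exists! v : Ver (P_dcat XS),
    src (ver0 (P_dcat XS)) v = d /\ A (tgt (ver0 (P_dcat XS)) v)).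

Let PX : aug_dcat := AugDCat Ah Av.

Lemma unit_aug n (x : X n) a : aug (a := W n) a -> aug (a := PX) (df_ob (unit_dfunctor x) a).
Proof.
case: a => i j ij /= e; rewrite /w_aug /= in e; subst j.
change (A (act (ob_mono (WOb ij)) x)); rewrite AE; exists (act (vertex i) x) => //; act_eq.
Qed.

Definition unit_fun n (x : X n) : aug_dfunctor (W n) PX := AugDFunctor (@unit_aug n x).

Lemma unit_nat m n (p : mono m n) (x : X n) :
  unit_fun (act p x) = aug_dfunctor_comp (unit_fun x) (W_map p).
Proof. by apply/aug_dfunctor_ext/dfunctor_ext => a /=; act_eq. Qed.

Definition unit_smap : smap X (S_obj PX) := @SMap X (S_obj PX) unit_fun unit_nat.

Lemma unit_bij n : bijective (unit_smap n).
Proof.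
have st : stable PX := P_stable XS.
apply: smap_bij_of_low => // [|[|[|[|//]]] _]; first exact: S_two_segal.
(* A 0-simplex amounts to an object of the augmentation, that is, a degenerate edge [degen 0 p], and
   a face of it recovers [p]. *)
- apply: bijective_of_surj => [x y e|F].
    have := congr1 (fun F : aug_dfunctor (W 0) PX => face 0 (df_ob F (obstep 0 0) : X 1)) e.
    rewrite /= /face -!act_comp.
    by rewrite (_ : mono_comp _ _ = mono_id 0) ?act_id //; apply: mono_ext => -[[|[]]].
  have a0 : aug (a := W 0) (obstep 0 0) by apply: val_inj.
  have : A (df_ob (F : aug_dfunctor (W 0) PX) (obstep 0 0)) := adf_aug (F : aug_dfunctor (W 0) PX) a0.
  rewrite AE => -[p _ Fp]; exists p; apply: (string_uniq (D := PX) st) => //=.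
  by rewrite -Fp; act_eq.
- apply: (@bijective_section _ _ _ (fun F : aug_dfunctor (W 1) PX => df_ob F gen_ob)).
    exact: gen_ob_inj.
  move=> x /=; rewrite -[RHS]act_id; act_eq.
apply: (@bijective_section _ _ _ (fun F : aug_dfunctor (W 2) PX => df_hor F gen_hor)).
  exact: gen_hor_inj.
move=> x /=; rewrite -[RHS]act_id; act_eq.
Qed.

End Unit.

(** * The equivalences *)

(** The unit runs from the identity to the composite, opposite to the direction in which the
    equivalence is stated. *)
Lemma naturally_isomorphic_sym (C D : category) (F G : functor C D) :
  naturally_isomorphic F G -> naturally_isomorphic G F.
Proof.
move=> [eta [nat iso]]; pose inv a := projT1 (cid (iso a)).
have invl a : ccomp (inv a) (eta a) = cid_ (F a) by rewrite /inv; case: cid => g [].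
have invr a : ccomp (eta a) (inv a) = cid_ (G a) by rewrite /inv; case: cid => g [].
exists inv; split=> [a b f|a]; last by exists (eta a).
rewrite -[LHS]cidr -(invr a) -cassoc [X in ccomp _ X]cassoc -(nat a b f).
by rewrite !cassoc invl cidl.
Qed.

Section Equivalence.
Variable HS : forall D : DCat_aug_st, unital_two_segal (S_obj (sval D)).

Lemma SP_iso : naturally_isomorphic (comp_functor (S_st HS) P_functor) (id_functor U2Seg).
Proof.
apply: naturally_isomorphic_sym.
exists (fun X : U2Seg => unit_smap (erefl (P_aug (XS := (svalP X).1)))
  (P_aug_hor (svalP X).2) (P_aug_ver (svalP X).2)).
split=> [X Y f|X].
  apply: smap_ext => n x; apply/aug_dfunctor_ext/dfunctor_ext => a; exact/esym/smap_nat.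
have [g [gl gr]] := smap_inv (unit_bij (erefl (P_aug (XS := (svalP X).1)))
  (P_aug_hor (svalP X).2) (P_aug_ver (svalP X).2)).
by exists g.
Qed.

Let seg (D : DCat_aug_st) : two_segal (S_obj (sval D)) := (svalP (S_st HS D)).1.
Let uni (D : DCat_aug_st) : unital (S_obj (sval D)) := (svalP (S_st HS D)).2.

Lemma PS_iso : naturally_isomorphic (comp_functor P_functor (S_st HS)) (id_functor DCat_aug_st).
Proof.
exists (fun D : DCat_aug_st => counit (seg D) (uni D)); split=> [D E f|D].
  by apply/aug_dfunctor_ext/dfunctor_ext.
have [g [gl gr]] := counit_inv (svalP D) (seg D) (uni D).
have ga a : aug a -> aug (a := P_obj (seg D) (uni D)) (df_ob g a).
  move=> /(counit_aug_surj (seg D) (uni D) (svalP D))[b bb <-].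
  by have -> : df_ob g (df_ob (counit (seg D) (uni D)) b) = b := congr1 (fun F => df_ob F b) gl.
by exists (AugDFunctor ga); split; apply: aug_dfunctor_ext.
Qed.

Variable HS_red : forall D : DCat_pt_st, reduced (S_obj (aug_of_pt (sval D))).

(* [P_pt] extracts this proof with the opaque [svalP], so it must have this form
   for the objects below to be convertible to those of [P_pt]. *)
Let sing_pt (X : U2Seg_red) : singleton_aug (sval (P_functor (sval X))) :=
  svalP (exist (fun D : DCat_aug => singleton_aug D) _ (P_singleton_aug X)).

Lemma SP_pt_iso :
  naturally_isomorphic (comp_functor (S_pt HS HS_red) P_pt) (id_functor U2Seg_red).
Proof.
apply: naturally_isomorphic_sym.
have AE (X : U2Seg_red) : [set aug_point (sing_pt X)]%classic = P_aug (XS := (svalP (sval X)).1).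
  exact/esym/aug_pointE.
exists (fun X : U2Seg_red => unit_smap (AE X)
  (aug_point_initial (sing_pt X)) (aug_point_terminal (sing_pt X))).
split=> [X Y f|X].
  apply: smap_ext => n x; apply/aug_dfunctor_ext/dfunctor_ext => a; exact/esym/smap_nat.
have [g [gl gr]] := smap_inv (unit_bij (AE X)
  (aug_point_initial (sing_pt X)) (aug_point_terminal (sing_pt X))).
by exists g.
Qed.

Lemma PS_pt_iso :
  naturally_isomorphic (comp_functor P_pt (S_pt HS HS_red)) (id_functor DCat_pt_st).
Proof.
pose D' (D : DCat_pt_st) := DCat_pt_st_to_aug D.
pose eta (D : DCat_pt_st) := counit (seg (D' D)) (uni (D' D)).
pose sing (D : DCat_pt_st) := sing_pt (S_pt HS HS_red D).
(* The chosen point lies in the augmentation of the path construction, which the counit sends into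
   the singleton of [pt (sval D)]. *)
have eta_pt (D : DCat_pt_st) : df_ob (eta D) (aug_point (sing D)) = pt (sval D).
  have : aug (a := P_obj (seg (D' D)) (uni (D' D))) (aug_point (sing D)).
    by rewrite [X in X _](aug_pointE (sing D)).
  exact: (adf_aug (eta D)).
exists (fun D : DCat_pt_st => @PtDFunctor (pt_of_aug (sing D)) (sval D) (eta D) (eta_pt D)).
split=> [D E f|D].
  by apply/pt_dfunctor_ext/dfunctor_ext.
have [g [gl gr]] := @counit_inv (aug_of_pt (sval D)) (svalP D) (seg (D' D)) (uni (D' D)).
have g_pt : df_ob g (pt (sval D)) = aug_point (sing D).
  rewrite -(eta_pt D); exact: (congr1 (fun F => df_ob F (aug_point (sing D))) gl).
exists (@PtDFunctor (sval D) (pt_of_aug (sing D)) g g_pt).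
by split; apply: pt_dfunctor_ext.
Qed.

End Equivalence.

Theorem theorem6p1 :
  exists (HS : forall D : DCat_aug_st, unital_two_segal (S_obj (sval D)))
         (HS_red : forall D : DCat_pt_st, reduced (S_obj (aug_of_pt (sval D)))),
    mutually_inverse_equivalences (S_st HS) P_functor /\
    mutually_inverse_equivalences (S_pt HS HS_red) P_pt.
Proof.
exists (fun D => conj (S_two_segal (svalP D)) (S_unital (svalP D))).
exists (fun D => S_reduced (svalP D)).
split; split.
- exact: SP_iso.
- exact: PS_iso.
- exact: SP_pt_iso.
- exact: PS_pt_iso.
Qed.
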